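(* Given $k\ge 0$ and $\delta\ge 0$ there are $K\ge 0$, $R\ge 0$ such that the following hold. Let $X$ be a $\delta$-hyperbolic geodesic metric space and $\{B_i\}$ a collection of $k$-quasiconvex subsets of $X$. Let $\widehat X$ denote the coned-off space obtained by coning the $B_i$'s and let $\iota:X\to\widehat X$ be the inclusion. (1) If $\gamma$ is a geodesic ray in $X$ that is an unbounded subset of $\widehat X$, then there is a $K$-quasigeodesic ray $\beta$ of $\widehat X$ having the same starting point as $\gamma$ such that the Hausdorff distance in $\widehat X$ satisfies $Hd_{\widehat X}(\gamma,\beta)\le R$. In particular $\{\gamma(n)\}$ converges to a point of $\partial\widehat X$. (2) Let $\partial_hX\subset\partial X$ be the set of $\xi\in\partial X$ such that $\xi=\gamma(\infty)$ for a quasigeodesic ray $\gamma$ in $X$ whose image $\iota(\gamma)$ is an unbounded subset of $\widehat X$. The map $\partial_hX\to\partial\widehat X$ sending $\xi=\gamma(\infty)$ to the limit of $\{\gamma(n)\}$ in $\partial\widehat X$ is a homeomorphism, where $\partial_hX$ has the subspace topology from $\partial X$. (3) If in addition the collection $\{B_i\}$ is locally finite, then for any geodesic ray $\gamma$ of $X$ which is bounded in $\widehat X$ we have $\gamma(\infty)\in\Lambda_X(B_j)$ for some $B_j$. In particular, in this case $$\partial X=\partial_hX\cup\Big(\bigcup_i\Lambda_X(B_i)\Big).$$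
   Context: A geodesic metric space is $\delta$-hyperbolic if every geodesic triangle is $\delta$-slim. A subset $A$ is $k$-quasiconvex if every geodesic with endpoints in $A$ lies in the closed $k$-neighborhood of $A$. A $K$-quasigeodesic ray is a $(K,K)$-quasiisometric embedding $[0,\infty)\to\widehat X$; a quasigeodesic ray is a $(K,K)$-quasiisometric embedding of $[0,\infty)$ for some $K$. The boundary $\partial X$ is the sequential Gromov boundary: classes of sequences with $(x_m.x_n)_x\to\infty$, where $\{x_n\}\sim\{y_n\}$ iff $(x_m.y_n)_x\to\infty$ (Gromov products), with its usual topology. For a quasigeodesic ray $\gamma$, $\gamma(\infty)$ is the class of $\{\gamma(n)\}$; every boundary point arises in this way. For $A\subset X$, $\Lambda_X(A)\subset\partial X$ is the set of limits in $\partial X$ of sequences in $A$. Coned-off space: $\widehat X$ is obtained from $X$ by adding for each $i$ a cone point $c_i$ and joining each point of $B_i$ to $c_i$ by an edge of length $1$, with the natural length metric; it is assumed to be geodesic (and it is hyperbolic). A collection $\{Z_i\}_{i\in I}$ of subsets of a metric space $Z$ is locally finite if for all $z\in Z$, $R>0$, the set $\{i:B(z,R)\cap Z_i\ne\emptyset\}$ is finite. *)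

(* Defs.v *)
From HB Require Import structures.
From mathcomp Require Import all_boot all_order all_algebra.
From mathcomp Require Import all_classical all_reals all_analysis.
From mathcomp Require Import lra.

Set Implicit Arguments.
Unset Strict Implicit.
Unset Printing Implicit Defensive.

Import Order.TTheory GRing.Theory Num.Theory.
Import numFieldNormedType.Exports.

Local Open Scope classical_set_scope.
Local Open Scope ring_scope.

Section metric_notions.
Context {R : realType} {M : metricType R}.
Implicit Types (A S T : set M) (r : R).

Definition closed_nbhd A r : set M :=
  [set x | exists2 a, A a & mdist x a <= r].

Definition bounded_subset A : Prop :=
  exists r, forall x y, A x -> A y -> mdist x y <= r.

Definition hausdorff_dist A T : \bar R :=
  ereal_inf [set r%:E | r in
    [set r | [/\ 0 <= r, A `<=` closed_nbhd T r & T `<=` closed_nbhd A r]]].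

(* Paths and rays are total functions R -> M of which only the restriction to
   the relevant interval matters. *)
Definition isometric_on (D : set R) (c : R -> M) : Prop :=
  forall s t, D s -> D t -> mdist (c s) (c t) = `|s - t|.

(* S is (the image of) a geodesic segment from x to y. *)
Definition geodesic_segment (x y : M) S : Prop :=
  exists c : R -> M, [/\ isometric_on `[0, mdist x y] c,
    c 0 = x, c (mdist x y) = y & S = c @` `[0, mdist x y]].

Definition ray_image (c : R -> M) : set M := c @` `[0, +oo[.

Definition geodesic_ray (c : R -> M) : Prop := isometric_on `[0, +oo[ c.

(* As usual for the multiplicative constant of a quasiisometric embedding,
   K >= 1. *)
Definition quasigeodesic_ray_with (K : R) (c : R -> M) : Prop :=
  1 <= K /\ forall s t, 0 <= s -> 0 <= t ->
    K^-1 * `|s - t| - K <= mdist (c s) (c t) <= K * `|s - t| + K.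

Definition quasigeodesic_ray (c : R -> M) : Prop :=
  exists K, quasigeodesic_ray_with K c.

Definition quasiconvex (k : R) A : Prop :=
  forall x y S, A x -> A y -> geodesic_segment x y S -> S `<=` closed_nbhd A k.

Definition locally_finite_family (I : Type) (B : I -> set M) : Prop :=
  forall (x : M) (r : R), 0 < r -> finite_set [set i | ball x r `&` B i !=set0].

Definition gromov_product (p x y : M) : R :=
  (mdist x p + mdist y p - mdist x y) / 2.

(* (u_m . v_n)_p --> +oo as m, n --> oo, for the base points p of M; the choice
   of p is immaterial, as it changes the products by a bounded amount. *)
Definition gromov_diverge (u v : nat -> M) : Prop :=
  forall p, gromov_product p (u k.1) (v k.2) @[k --> filter_prod \oo \oo] --> +oo.

End metric_notions.

Definition geodesic_space (R : realType) (M : metricType R) : Prop :=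
  forall x y : M, exists S, geodesic_segment x y S.

Definition slim_triangle (R : realType) (M : metricType R) (delta : R)
    (S1 S2 S3 : set M) : Prop :=
  [/\ S1 `<=` closed_nbhd (S2 `|` S3) delta,
      S2 `<=` closed_nbhd (S3 `|` S1) delta
    & S3 `<=` closed_nbhd (S1 `|` S2) delta].

Definition hyperbolic (R : realType) (delta : R) (M : metricType R) : Prop :=
  forall (x y z : M) (S1 S2 S3 : set M),
    geodesic_segment x y S1 -> geodesic_segment y z S2 ->
    geodesic_segment z x S3 -> slim_triangle delta S1 S2 S3.

(* A boundary point is an equivalence class, regarded as a set of sequences. *)
Record gromov_boundary (R : realType) (M : metricType R) := GromovBoundary {
  bdry_class :> set (nat -> M);
  bdry_classP : exists2 u, gromov_diverge u u &
    bdry_class = [set v | gromov_diverge v v /\ gromov_diverge u v] }.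

Definition converges_to (R : realType) (M : metricType R)
    (u : nat -> M) (xi : gromov_boundary M) : Prop := bdry_class xi u.

(* c(oo) = xi *)
Definition ray_endpoint (R : realType) (M : metricType R)
    (c : R -> M) (xi : gromov_boundary M) : Prop :=
  converges_to (fun n => c n%:R) xi.

Definition limit_set (R : realType) (M : metricType R) (A : set M) :
    set (gromov_boundary M) :=
  [set xi | exists2 u : nat -> M, (forall n, A (u n)) & converges_to u xi].

(* (xi . eta)_p = sup liminf_(m, n) (u_m . v_n)_p over u in xi, v in eta *)
Definition bdry_product (R : realType) (M : metricType R) (p : M)
    (xi eta : gromov_boundary M) : \bar R :=
  ereal_sup
    [set limf_einf (fun k : nat * nat => (gromov_product p (u k.1) (v k.2))%:E)
                   (filter_prod \oo \oo)
     | u in bdry_class xi & v in bdry_class eta].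

Section boundary_topology.
Context {R : realType} {M : metricType R}.

HB.instance Definition _ := gen_eqMixin (gromov_boundary M).
HB.instance Definition _ := gen_choiceMixin (gromov_boundary M).

(* U is open iff it contains, with each xi, some
   {eta | (xi . eta)_p > r}; in a hyperbolic space the latter sets form a
   fundamental system of neighborhoods of xi. *)
Definition bdry_open (U : set (gromov_boundary M)) : Prop :=
  forall xi, U xi -> forall p, exists r : R,
    forall eta, (r%:E < bdry_product p xi eta)%E -> U eta.

Let bdry_openT : bdry_open setT.
Proof. by move=> xi _ p; exists 0. Qed.

Let bdry_openI : setI_closed bdry_open.
Proof.
move=> U V oU oV xi [Ux Vx] p.
have [r hr] := oU _ Ux p; have [s hs] := oV _ Vx p.
exists (Num.max r s) => eta h; split; [apply: hr|apply: hs];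
  by apply: le_lt_trans h; rewrite lee_fin le_max lexx ?orbT.
Qed.

Let bdry_open_bigU (I : Type) (f : I -> set (gromov_boundary M)) :
  (forall i, bdry_open (f i)) -> bdry_open (\bigcup_i f i).
Proof.
move=> of_ xi [i _ fx] p; have [r hr] := of_ i _ fx p.
by exists r => eta /hr ?; exists i.
Qed.

HB.instance Definition _ := isOpenTopological.Build (gromov_boundary M)
  bdry_openT bdry_openI bdry_open_bigU.

End boundary_topology.

Definition homeomorphism (S T : topologicalType) (f : S -> T) : Prop :=
  continuous f /\ exists g : T -> S, [/\ continuous g, cancel f g & cancel g f].

Section coned_off.
Context {R : realType} {X : metricType R} {I : Type} (B : I -> set X).

Definition open_unit_interval := {t : R | 0 < t < 1}.

(* Edges are indexed by the pairs (i, x) with x in B i; only their interior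
   points are listed, their ends being Base x and Apex i. *)
Definition cone_edge := {i : I & set_type (B i)}.

Inductive coned_point :=
| Base of X
| EdgePoint of cone_edge & open_unit_interval
| Apex of I.

Definition edge_foot (e : cone_edge) : X := set_val (projT2 e).

(* The point of e at distance t from edge_foot e, for 0 <= t <= 1. *)
Definition edge_at (e : cone_edge) (t : R) : coned_point :=
  if insub t is Some s then EdgePoint e s
  else if t <= 0 then Base (edge_foot e) else Apex (projT1 e).

Inductive cone_step : coned_point -> coned_point -> R -> Prop :=
| StepBase x y : cone_step (Base x) (Base y) (mdist x y)
| StepEdge e s t : 0 <= s <= 1 -> 0 <= t <= 1 ->
    cone_step (edge_at e s) (edge_at e t) `|s - t|.

Inductive cone_chain : coned_point -> coned_point -> R -> Prop :=
| Chain0 p : cone_chain p p 0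
| ChainS p q r l m :
    cone_step p q l -> cone_chain q r m -> cone_chain p r (l + m).

(* The infimum of the lengths of the finite concatenations of segments of X and
   of edges; when X is a length space this is the path metric obtained by gluing
   the unit edges to X. *)
Definition cone_dist (p q : coned_point) : R := inf [set l | cone_chain p q l].

Lemma edge_at0 e : edge_at e 0 = Base (edge_foot e).
Proof. by rewrite /edge_at insubF ?ltxx// lexx. Qed.

Lemma edge_at1 e : edge_at e 1 = Apex (projT1 e).
Proof. by rewrite /edge_at insubF ?ltxx ?andbF// ler10. Qed.

Lemma edge_at_val e (t : open_unit_interval) : edge_at e (val t) = EdgePoint e t.
Proof. by rewrite /edge_at valK. Qed.

Lemma cone_step_sym p q l : cone_step p q l -> cone_step q p l.
Proof.
case=> [x y|e s t hs ht]; first by rewrite metric_sym; constructor.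
by rewrite distrC; constructor.
Qed.

Lemma cone_chain_cat p q r l m :
  cone_chain p q l -> cone_chain q r m -> cone_chain p r (l + m).
Proof.
elim=> [?|p' q' r' l' m' h _ IH /IH hc]; first by rewrite add0r.
by rewrite -addrA; apply: ChainS h hc.
Qed.

Lemma cone_chain_step p q l : cone_step p q l -> cone_chain p q l.
Proof. by move=> h; rewrite -[l]addr0; apply: ChainS h (Chain0 _). Qed.

Lemma cone_chain_sym p q l : cone_chain p q l -> cone_chain q p l.
Proof.
elim=> [?|p' q' r' l' m' h _ IH]; first exact: Chain0.
rewrite addrC; apply: cone_chain_cat IH _.
exact/cone_chain_step/cone_step_sym.
Qed.

Lemma cone_chain_ge0 p q l : cone_chain p q l -> 0 <= l.
Proof.
elim=> // p' q' r' l' m' [x y|e s t _ _] _ h; apply: addr_ge0 => //.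
exact: mdist_ge0.
Qed.

Lemma cone_dist_le p q l : cone_chain p q l -> cone_dist p q <= l.
Proof. by move=> h; apply: ge_inf => //; exists 0 => m /cone_chain_ge0. Qed.

Section potential.
Variables (fb : X -> R) (fe : cone_edge -> R -> R) (fa : I -> R).
Hypothesis fe0 : forall e, fe e 0 = fb (edge_foot e).
Hypothesis fe1 : forall e, fe e 1 = fa (projT1 e).
Hypothesis fbL : forall x y, fb y - fb x <= mdist x y.
Hypothesis feL : forall e s t, 0 <= s <= 1 -> 0 <= t <= 1 ->
  fe e t - fe e s <= `|s - t|.

Definition cone_potential (p : coned_point) : R :=
  match p with
  | Base x => fb x | EdgePoint e t => fe e (val t) | Apex i => fa i
  end.

Lemma cone_potential_edge e t : 0 <= t <= 1 ->
  cone_potential (edge_at e t) = fe e t.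
Proof.
move=> /andP[t0 t1]; rewrite /edge_at; case: insubP => [s _ <- //|].
rewrite negb_and -!leNgt => ht; case: (leP t 0) => h /=.
  by have -> : t = 0 by [lra]; rewrite fe0.
have -> : t = 1 by move: ht; rewrite leNgt h /=; lra.
by rewrite fe1.
Qed.

Lemma cone_potential_chain p q l :
  cone_chain p q l -> cone_potential q - cone_potential p <= l.
Proof.
elim=> [?|p' q' r' l' m' h _ IH]; first by rewrite subrr.
suff : cone_potential q' - cone_potential p' <= l' by lra.
case: h => [x y|e s t hs ht]; first exact: fbL.
by rewrite !cone_potential_edge//; apply: feL.
Qed.

End potential.

Hypothesis B0 : forall i, B i !=set0.

Lemma cone_chain_base_edge e t : 0 <= t <= 1 ->
  exists l, cone_chain (Base (edge_foot e)) (edge_at e t) l.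
Proof.
move=> ht; exists `|0 - t|; apply: cone_chain_step.
by rewrite -edge_at0; constructor; rewrite ?lexx ?ler01.
Qed.

Lemma cone_chain_from_base p : exists x l, cone_chain (Base x) p l.
Proof.
case: p => [x|e t|i]; first by exists x, 0; apply: Chain0.
- exists (edge_foot e); rewrite -edge_at_val; apply: cone_chain_base_edge.
  by case/andP: (valP t) => h1 h2; rewrite !ltW.
- have [x Bx] := B0 i; pose e : cone_edge := existT _ i (SigSub (mem_set Bx)).
  exists (edge_foot e); rewrite -[i]/(projT1 e) -edge_at1.
  by apply: cone_chain_base_edge; rewrite lexx ler01.
Qed.

Lemma cone_chain_ex p q : exists l, cone_chain p q l.
Proof.
have [x [l /cone_chain_sym hl]] := cone_chain_from_base p.
have [y [m hm]] := cone_chain_from_base q; exists (l + (mdist x y + m)).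
by apply: cone_chain_cat hl _; apply: ChainS hm; constructor.
Qed.

Lemma cone_dist_has_inf p q : has_inf [set l | cone_chain p q l].
Proof.
split; first by have [l] := cone_chain_ex p q; exists l.
by exists 0 => m /cone_chain_ge0.
Qed.

Lemma cone_dist_ge0 p q : 0 <= cone_dist p q.
Proof.
apply: lb_le_inf; first exact: (cone_dist_has_inf p q).1.
by move=> l /cone_chain_ge0.
Qed.

Lemma cone_distxx p : cone_dist p p = 0.
Proof.
by apply/eqP; rewrite eq_le cone_dist_ge0 andbT; apply/cone_dist_le/Chain0.
Qed.

Lemma cone_dist_sym p q : cone_dist p q = cone_dist q p.
Proof.
rewrite /cone_dist; congr inf.
by apply/seteqP; split=> l /cone_chain_sym.
Qed.

Lemma cone_dist_triangle q p r : cone_dist p r <= cone_dist p q + cone_dist q r.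
Proof.
apply/ler_addgt0Pl => e e0; have e20 : 0 < e / 2 by rewrite divr_gt0.
have [l hl lt_l] := inf_adherent e20 (cone_dist_has_inf p q).
have [m hm lt_m] := inf_adherent e20 (cone_dist_has_inf q r).
have := cone_dist_le (cone_chain_cat hl hm); rewrite /cone_dist in lt_l lt_m *.
by lra.
Qed.

Lemma cone_potential_dist fb fe fa p q :
  (forall e, fe e 0 = fb (edge_foot e)) ->
  (forall e, fe e 1 = fa (projT1 e)) ->
  (forall x y, fb y - fb x <= mdist x y) ->
  (forall e s t, 0 <= s <= 1 -> 0 <= t <= 1 -> fe e t - fe e s <= `|s - t|) ->
  cone_potential fb fe fa q - cone_potential fb fe fa p <= cone_dist p q.
Proof.
move=> h0 h1 hb he; apply: lb_le_inf; first exact: (cone_dist_has_inf p q).1.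
by move=> l; apply: cone_potential_chain.
Qed.

Let minL (a b c l : R) : b - c <= l -> 0 <= l -> Num.min a b - Num.min a c <= l.
Proof. by move=> h l0; case: (leP a b) => ?; case: (leP a c) => ?; lra. Qed.

Lemma cone_dist_positivity p q : cone_dist p q = 0 -> p = q.
Proof.
case: p => [x|e t|i] d0.
- pose fb y := Num.min 1 (mdist x y).
  pose fe (e : cone_edge) t := Num.min 1 (mdist x (edge_foot e) + t).
  have : cone_potential fb fe (fun=> 1) q
         - cone_potential fb fe (fun=> 1) (Base x) <= 0.
    rewrite -d0; apply: cone_potential_dist => [e|e|y z|e s t hs ht].
    + by rewrite /fe addr0.
    + by rewrite /fe min_l// lerDr mdist_ge0.
    + apply: minL; last exact: mdist_ge0.
      by rewrite lerBlDl; apply: metric_triangle.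
    + by apply: minL => //; have := ler_norm (t - s); rewrite distrC; lra.
  case: q d0 => [y|e t|i] _ /=; rewrite /fb /fe mdistxx (min_r (@ler01 _)) subr0.
  * rewrite ge_min [1 <= 0]leNgt ltr01/= => h.
    congr Base; apply/mdist_positivity/eqP.
    by rewrite eq_le h mdist_ge0.
  * case/andP: (valP t) => t0 _; have d1 := mdist_ge0 x (edge_foot e).
    by rewrite ge_min [1 <= 0]leNgt ltr01/= leNgt ltr_wpDl.
  * by rewrite leNgt ltr01.
- case/andP: (valP t) => t0 t1; set m := Num.min (val t) (1 - val t).
  have m0 : 0 < m by rewrite lt_min t0 subr_gt0.
  have [mt mt'] : m <= val t /\ m <= 1 - val t.
    by split; rewrite ge_min lexx ?orbT.
  pose fe (e' : cone_edge) s :=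
    if `[< e' = e >] then Num.min m `|s - val t| else m.
  have : cone_potential (fun=> m) fe (fun=> m) q
         - cone_potential (fun=> m) fe (fun=> m) (EdgePoint e t) <= 0.
    rewrite -d0; apply: cone_potential_dist => [e'|e'|y z|e' s s' _ _].
    + rewrite /fe; case: asboolP => // _; rewrite min_l// sub0r normrN gtr0_norm//.
    + by rewrite /fe; case: asboolP => // _; rewrite min_l// gtr0_norm// subr_gt0.
    + by rewrite subrr mdist_ge0.
    + rewrite /fe; case: asboolP => // _; last by rewrite subrr.
      apply: minL => //; rewrite (le_trans (lerB_dist _ _))// distrC.
      by rewrite opprB addrA subrK.
  have -> : cone_potential (fun=> m) fe (fun=> m) (EdgePoint e t) = 0.
    by rewrite /= /fe; case: asboolP => // _; rewrite subrr normr0 min_r// ltW.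
  rewrite subr0; case: q d0 => [y|e' s|i] _ /=; rewrite ?(leNgt m) ?m0//.
  rewrite /fe; case: asboolP => [->|_]; last by rewrite leNgt m0.
  rewrite ge_min [m <= 0]leNgt m0/= normr_le0 subr_eq0 => /eqP h.
  by congr EdgePoint; apply: val_inj.
- pose fa j : R := if `[< j = i >] then 0 else 1.
  pose fe (e : cone_edge) t : R :=
    if `[< projT1 e = i >] then 1 - t else 1.
  have : cone_potential (fun=> 1) fe fa q
         - cone_potential (fun=> 1) fe fa (Apex i) <= 0.
    rewrite -d0; apply: cone_potential_dist => [e|e|y z|e s t _ _].
    + by rewrite /fe subr0; case: asboolP.
    + by rewrite /fe /fa subrr.
    + by rewrite subrr mdist_ge0.
    + rewrite /fe; case: asboolP => // _; last by rewrite subrr.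
      by have := ler_norm (s - t); lra.
  have -> : cone_potential (fun=> 1) fe fa (Apex i) = 0.
    by rewrite /= /fa; case: asboolP.
  rewrite subr0; case: q d0 => [y|e s|j] _ /=.
  * by rewrite leNgt ltr01.
  * case/andP: (valP s) => _ s1; rewrite /fe.
    by case: asboolP => _; rewrite leNgt ?subr_gt0 ?s1 ?ltr01.
  * by rewrite /fa; case: asboolP => [-> //|_]; rewrite leNgt ltr01.
Qed.

(* The argument B0 makes the coned-off space connected, so that cone_dist is
   indeed a (finite) distance. *)
Definition coned_off : Type := let _ := B0 in coned_point.

HB.instance Definition _ := gen_eqMixin coned_off.
HB.instance Definition _ := gen_choiceMixin coned_off.
HB.instance Definition _ := @isMetric.Build R coned_off
  cone_dist cone_distxx cone_dist_positivity cone_dist_sym cone_dist_triangle.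

Definition cone_incl : X -> coned_off := Base.

End coned_off.

(* The points of the boundary of X represented by quasigeodesic rays which are
   unbounded in the coned-off space. *)
Definition horizontal_boundary (R : realType) (X : metricType R) (I : Type)
    (B : I -> set X) (B0 : forall i, B i !=set0) : set (gromov_boundary X) :=
  [set xi | exists gamma : R -> X, [/\ quasigeodesic_ray gamma,
     ~ bounded_subset (cone_incl B0 @` ray_image gamma)
   & ray_endpoint gamma xi]].

(* Main.v *)
(* For x, y in X let rho(x, y) be their distance in the coned-off space, so that
   rho <= d.  An X-geodesic joining two points of one B_i is rho-bounded because
   B_i is quasiconvex, so X-geodesics with rho-close ends are rho-bounded; as
   they also form slim triangles, the guessing-geodesics argument shows that an
   X-geodesic stays rho-close to the coned-off geodesic with the same ends.
   Everything rests on one consequence: there is c = c(k, delta) such that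
     rho(x, p) + rho(p, y) <= rho(x, y) + c  for p on an X-geodesic [x, y].
   It makes the Gromov product of rho comparable to the rho-distance to an
   X-geodesic, whence the four-point condition for rho and a bound of the
   products of rho by those of d.

   (1) Reparametrize gamma by rho(gamma(0), gamma(t)); the inequality above says
   that the result is a (1, c)-quasigeodesic.
   (2) Sequences of X diverging for rho diverge for d, which gives a continuous
   map from the boundary of the coned-off space to that of X.  Conversely, for
   xi in the horizontal boundary, geodesics to xi pass through points that are
   rho-far from the base point at bounded d-distance, so that large d-products
   with xi force large rho-products.
   (3) If gamma is rho-bounded, its segments [gamma(0), gamma(m)] are covered by
   a bounded number of sets, each of bounded diameter or near some B_j.  By
   local finiteness and the pigeonhole principle, gamma returns infinitely often
   to a neighborhood of one B_j. *)
Require Import Defs.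
From mathcomp Require Import all_boot all_order all_algebra.
From mathcomp Require Import all_classical all_reals all_analysis.
From mathcomp Require Import lra.
Set Implicit Arguments.
Unset Strict Implicit.
Unset Printing Implicit Defensive.
Import Order.TTheory GRing.Theory Num.Theory.
Import numFieldNormedType.Exports.
Local Open Scope classical_set_scope.
Local Open Scope ring_scope.

(** * Real-variable tools: logarithmic growth, connectedness of intervals *)

Section real_lemmas.
Context {R : realType}.
Implicit Types (a b c e : R).

Lemma affine_le_exp2 a b :
  exists N, forall n, (N <= n)%N -> a * n%:R + b <= 2 ^+ n.
Proof.
have [m hm] : exists m : nat, 2 * `|a| + `|b| + 1 <= m%:R.
  by exists (Num.truncn (2 * `|a| + `|b| + 1)).+1; exact/ltW/truncnS_gt.
have pow2 (n : nat) : n%:R <= 2 ^+ n :> R.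
  by rewrite -natrX ler_nat; apply/ltnW/ltn_expl.
exists (m + m)%N; elim=> [|n IH] hn.
  move: hn; rewrite leqn0 addn_eq0 andbb => /eqP m0; move: hm; rewrite m0.
  by have := normr_ge0 a; have := normr_ge0 b; lra.
have [le_n|lt_n] := leqP (m + m) n; last first.
  have <- : (m + m = n.+1)%N by apply/eqP; rewrite eqn_leq hn.
  rewrite exprD natrD; have := pow2 m; set u : R := 2 ^+ m; set v : R := m%:R.
  have := ler_norm a; have := ler_norm b; have := normr_ge0 a.
  have := normr_ge0 b; rewrite -/v in hm => b0 a0 hb ha vu; nra.
have := IH le_n; rewrite exprS -natr1.
have : a <= 2 ^+ n; last by lra.
apply: le_trans (pow2 n); have : m%:R <= n%:R :> R.
  by rewrite ler_nat (leq_trans _ le_n)// leq_addr.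
by have := ler_norm a; have := normr_ge0 a; have := normr_ge0 b; lra.
Qed.

(** Makes D = O(log D) into a bound uniform in [D], without logarithms. For large [n],
    [D <= c * n.+1%:R + e] implies [a * D + b <= 2 ^+ n], hence the same bound with [n]; the descent
    stops at a fixed [N]. *)
Lemma log_growth_bound a b c e : 0 <= a -> 0 <= c ->
  exists D0, forall D, (forall n, a * D + b <= 2 ^+ n -> D <= c * n%:R + e) ->
    D <= D0.
Proof.
move=> a0 c0; have [N hN] := affine_le_exp2 (a * c) (a * (c + e) + b).
exists (c * N%:R + e) => D hD.
have step n : (N <= n)%N -> D <= c * n.+1%:R + e -> D <= c * n%:R + e.
  move=> /hN h1 h2; apply: hD; apply: le_trans h1.
  have := ler_wpM2l a0 h2; rewrite -natr1; lra.
have [N' hN'] := affine_le_exp2 0 (a * D + b).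
have : D <= c * (N + N')%:R + e.
  by apply: hD; have := hN' _ (leq_addl N N'); rewrite mul0r add0r.
elim: N' {hN'} => [|n IH]; first by rewrite addn0.
by rewrite addnS => /step h; apply/IH/h/leq_addr.
Qed.

Lemma cover_crossing (P Q : R -> Prop) b : 0 <= b ->
  (forall t, 0 <= t <= b -> P t \/ Q t) -> P 0 -> Q b ->
  exists s t, [/\ 0 <= s <= b, 0 <= t <= b, `|s - t| <= 1, P s & Q t].
Proof.
move=> b0 PQ P0 Qb; pose E := [set t | 0 <= t <= b /\ P t].
have supE : has_sup E.
  by split; [exists 0; rewrite /E/= lexx b0|exists b => t [/andP[]]].
have E0 : E 0 by rewrite /E/= lexx b0.
have [s [hs Ps] lt_s] := sup_adherent (@ltr01 R) supE.
have ss : s <= sup E by apply: ub_le_sup; [exact: supE.2|].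
exists s; have [le_b|lt_b] := leP b (s + 1).
  exists b; split=> //; first by rewrite b0 lexx.
  by case/andP: hs => *; rewrite distrC ger0_norm; lra.
exists (s + 1); split=> //.
- by case/andP: hs => *; apply/andP; split; lra.
- by rewrite distrC addrAC subrr add0r normr1.
- case: (PQ (s + 1)) => //; first by case/andP: hs => *; apply/andP; split; lra.
  move=> Pt; have : s + 1 <= sup E.
    apply: ub_le_sup; first exact: supE.2.
    by split=> //; case/andP: hs => *; apply/andP; split; lra.
  by lra.
Qed.

Lemma ivt_lipschitz (g : R -> R) b v :
  (forall s t, 0 <= s <= b -> 0 <= t <= b -> g s - g t <= `|s - t|) ->
  0 <= b -> g 0 <= v <= g b -> exists2 t, 0 <= t <= b & g t = v.
Proof.
move=> gL b0 /andP[gv vg]; pose E := [set t | 0 <= t <= b /\ g t <= v].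
have E0 : E 0 by rewrite /E/= lexx b0.
have supE : has_sup E by split; [exists 0; exact: E0|exists b => t [/andP[]]].
have ubE t : E t -> t <= sup E by move=> ?; apply: ub_le_sup; [exact: supE.2|].
have s0 := ubE _ E0; have sb : sup E <= b by apply: ge_sup => [|t [/andP[]]];
  first exact: supE.1.
have hs : 0 <= sup E <= b by rewrite s0.
exists (sup E) => //.
apply/eqP; rewrite eq_le; apply/andP; split; rewrite leNgt; apply/negP => h.
- have h' : 0 < g (sup E) - v by rewrite subr_gt0.
  have [t Et lt_t] := sup_adherent h' supE; have := ubE _ Et.
  case: Et => ht gt ?; have := gL (sup E) t hs ht.
  by rewrite ger0_norm; lra.
- pose t := Num.min b (sup E + (v - g (sup E))).
  have t_gt : sup E < t.
    rewrite lt_min ltrDl subr_gt0 h andbT lt_neqAle sb andbT.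
    by apply/eqP => eb; move: h; rewrite eb ltNge vg.
  have [tb tv] : t <= b /\ t <= sup E + (v - g (sup E)).
    by split; rewrite ge_min lexx ?orbT.
  have ht : 0 <= t <= b by rewrite tb (le_trans s0 (ltW t_gt)).
  suff /ubE : E t by rewrite leNgt t_gt.
  split=> //.
  by have := gL t (sup E) ht hs; rewrite ger0_norm; lra.
Qed.

End real_lemmas.

(** * Geodesics through the betweenness relation *)

Definition between (R : realType) (M : metricType R) (x p y : M) :=
  mdist x p + mdist p y = mdist x y.

Section between_lemmas.
Context {R : realType} {M : metricType R}.
Implicit Types (x y z p q : M).

Lemma betweenC x p y : between x p y -> between y p x.
Proof. by rewrite /between (metric_sym y p) (metric_sym p x) addrC (metric_sym
  y x). Qed.

Lemma between_l x y : between x x y.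
Proof. by rewrite /between mdistxx add0r. Qed.

Lemma between_r x y : between x y y.
Proof. by rewrite /between mdistxx addr0. Qed.

Lemma between_le x p y : between x p y -> mdist x p <= mdist x y.
Proof. by move=> <-; rewrite lerDl mdist_ge0. Qed.

Lemma between_inner x p q y r : between x p y ->
  between x q p -> between p r y -> between q p r.
Proof.
rewrite /between => h1 h2 h3; apply/eqP; rewrite eq_le metric_triangle andbT.
have := metric_triangle x q y; have := metric_triangle q r y; lra.
Qed.

Lemma between_trans_l x p q y :
  between x p y -> between x q p -> between x q y /\ between q p y.
Proof.
rewrite /between => h1 h2; have h3 := metric_triangle x q y.
by have h4 := metric_triangle q p y; split; apply/eqP; rewrite eq_le;
  apply/andP;
  split; lra.
Qed.

Definition geodesic_path x y (c : R -> M) := [/\ c 0 = x, c (mdist x y) = y &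
  forall s t, 0 <= s <= mdist x y -> 0 <= t <= mdist x y ->
    mdist (c s) (c t) = `|s - t|].

Lemma geodesic_path_between x y c s : geodesic_path x y c ->
  0 <= s <= mdist x y -> between x (c s) y /\ mdist x (c s) = s.
Proof.
move=> [c0 cd cI] hs; have d0 := mdist_ge0 x y.
have e1 : mdist x (c s) = s.
  by rewrite -{1}c0 cI ?lexx// sub0r normrN ger0_norm//; case/andP: hs.
split=> //; rewrite /between e1 -{1}cd cI ?lexx ?d0// distrC ger0_norm.
  by rewrite addrC subrK.
by case/andP: hs => _; rewrite subr_ge0.
Qed.

Lemma segment_between x y (S : set M) p :
  geodesic_segment x y S -> S p -> between x p y.
Proof.
move=> [c [cI c0 cd ->]] [s]; rewrite /= in_itv /= => hs <-.
by apply: (geodesic_path_between _ hs).1.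
Qed.

Hypothesis geoM : geodesic_space M.

Lemma geodesic_pathP x y : exists c, geodesic_path x y c.
Proof.
have [S [c [cI c0 cd _]]] := geoM x y; exists c; split=> // s t hs ht.
Qed.

Lemma between_exists x y (t : R) : 0 <= t <= mdist x y ->
  exists2 p, between x p y & mdist x p = t.
Proof.
have [c hc] := geodesic_pathP x y => ht.
by have [h1 h2] := geodesic_path_between hc ht; exists (c t).
Qed.

(** Concatenation of [x, p] and [p, y]. With [segment_between] it identifies betweenness with lying
    on some geodesic, so that geodesics can be treated as a relation on points. *)
Lemma between_segment x p y : between x p y ->
  exists2 S, geodesic_segment x y S & S p.
Proof.
have [c1 [c10 c1d c1I]] := geodesic_pathP x p.
have [c2 [c20 c2d c2I]] := geodesic_pathP p y.
rewrite /between => hp; set a := mdist x p in hp c1d c1I.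
set b := mdist p y in hp c2d c2I.
have a0 : 0 <= a := mdist_ge0 _ _; have b0 : 0 <= b := mdist_ge0 _ _.
pose c t := if t <= a then c1 t else c2 (t - a).
have ca : c a = p by rewrite /c lexx.
have cI s t : 0 <= s <= a + b -> 0 <= t <= a + b -> s <= t ->
    mdist (c s) (c t) = t - s.
  move=> /andP[s0 sb] /andP[t0 tb] st; rewrite /c.
  case: (leP t a) => ta; first rewrite (le_trans st ta) c1I.
  - by rewrite distrC ger0_norm// subr_ge0.
  - by rewrite s0 (le_trans st ta).
  - by rewrite t0.
  case: (leP s a) => sa; last first.
    by rewrite c2I 1?distrC ?ger0_norm; try (apply/andP; split); lra.
  have e1 : mdist x (c1 s) = s.
    by rewrite -{1}c10 c1I ?lexx ?a0 ?s0// sub0r normrN ger0_norm.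
  have e2 : mdist (c1 s) p = a - s.
    by rewrite -c1d c1I ?lexx ?a0 ?s0// distrC ger0_norm// subr_ge0.
  have e3 : mdist p (c2 (t - a)) = t - a.
    rewrite -{1}c20 c2I ?lexx ?b0//; last by apply/andP; split; lra.
    by rewrite sub0r normrN ger0_norm// subr_ge0 ltW.
  have e4 : mdist (c2 (t - a)) y = b - (t - a).
    rewrite -c2d c2I ?lexx ?b0//; last by apply/andP; split; lra.
    by rewrite distrC ger0_norm//; lra.
  (* The upper bound goes through [p]. A shorter jump from [c1 s] to [c2 (t - a)] would yield a path
     from [x] to [y] shorter than [a + b]. *)
  apply/eqP; rewrite eq_le; apply/andP; split.
    by have := metric_triangle (c1 s) p (c2 (t - a)); lra.
  have := metric_triangle x (c1 s) y.
  by have := metric_triangle (c1 s) (c2 (t - a)) y; lra.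
exists (c @` `[0, mdist x y]); last first.
  by exists a => //; rewrite /= in_itv/= a0 -hp lerDl.
exists c; rewrite -hp; split=> //.
- move=> s t /=; rewrite !in_itv/= => hs ht; have [st|/ltW st] := leP s t.
    by rewrite cI// distrC ger0_norm// subr_ge0.
  by rewrite metric_sym cI// ger0_norm// subr_ge0.
- by rewrite /c a0.
- rewrite /c; case: leP => h; first have b00 : b = 0 by lra.
    by rewrite b00 addr0 c1d -c20 -c2d b00.
  by rewrite addrC addKr.
Qed.

End between_lemmas.

(** * Slim triangles and polygons *)

Definition slim_space (R : realType) (delta : R) (M : metricType R) :=
  forall x p y z : M, between x p y ->
    exists2 q, between x q z \/ between z q y & mdist p q <= delta.

Lemma hyperbolic_slim (R : realType) (M : metricType R) (delta : R) :
  geodesic_space M -> hyperbolic delta M -> slim_space delta M.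
Proof.
move=> geo hyp x p y z /(between_segment geo)[S1 hS1 S1p].
have [[S2 hS2] [S3 hS3]] := (geo y z, geo z x).
have [/(_ p S1p)[q [S2q|S3q] pq] _ _] := hyp _ _ _ _ _ _ hS1 hS2 hS3;
  exists q => //; [right|left]; apply: betweenC;
    exact: segment_between S2q || exact: segment_between S3q.
Qed.

(** Bisection: each halving of the chain of sides costs [delta], so the loss is logarithmic in the
    number of sides. The alternative [q = z j] serves the empty chain [a = b]. *)
Lemma polygon_slim (R : realType) (delta : R) (M : metricType R) (z : nat -> M)
    n a b p :
  slim_space delta M -> 0 <= delta -> (a <= b <= a + 2 ^ n)%N ->
  between (z a) p (z b) ->
  exists j q, [/\ (a <= j <= b)%N,
    q = z j \/ (j < b)%N /\ between (z j) q (z j.+1) &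
      mdist p q <= delta * n%:R].
Proof.
move=> slim d0; elim: n a b p => [|n IH] a b p /andP[ab ba] hp.
  have := ba; rewrite expn0 addn1 leq_eqVlt ltnS => /orP[/eqP eb|ba'].
    exists a, p; rewrite eb leqnn leqnSn mulr0 mdistxx; split=> //.
    by right; split=> //; rewrite -eb.
  have eb : a = b by apply/eqP; rewrite eqn_leq ab.
  exists a, (z a); rewrite -eb leqnn; split=> //; first by left.
  move: hp; rewrite /between -eb mdistxx => hp; rewrite mulr0 metric_sym.
  by have := mdist_ge0 p (z a); lra.
have [le_b|lt_b] := leqP b (a + 2 ^ n).
  have [||j [q [h1 h2 h3]]] := IH a b p; rewrite ?ab//.
  exists j, q; split=> //; apply: le_trans h3 _.
  by rewrite ler_wpM2l// ler_nat.
have [q [hq|hq] pq] := slim _ _ _ (z (a + 2 ^ n)%N) hp.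
- have [||j [q' [h1 h2 h3]]] := IH a (a + 2 ^ n)%N q;
    rewrite ?leq_addr ?leqnn//.
  exists j, q'; split.
  + by case/andP: h1 => -> /leq_trans->//; exact: ltnW.
  + case: h2 => [->|[hj ?]]; [by left|right; split=> //].
    exact: ltn_trans hj lt_b.
  + by have := metric_triangle p q q'; rewrite -natr1; lra.
- have [||j [q' [h1 h2 h3]]] := IH (a + 2 ^ n)%N b q; rewrite ?(ltnW lt_b)//.
    by rewrite -addnA addnn -mul2n -expnS ba.
  exists j, q'; split=> //.
  + by case/andP: h1 => /(leq_trans _)->//; exact: leq_addr.
  + by have := metric_triangle p q q'; rewrite -natr1; lra.
Qed.

(** * Coarse metrics dominated by the distance *)

Section coarse_metric.
Context {R : realType} {M : metricType R}.
Variable rho : M -> M -> R.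

Definition dominated_pseudometric := [/\ forall x y, 0 <= rho x y,
  forall x y, rho x y = rho y x, forall y x z, rho x z <= rho x y + rho y z &
  forall x y, rho x y <= mdist x y].

(** Slimness only produces points on geodesics of [M] between consecutive [z j]; this condition
    makes such points [rho]-close to the chain. *)
Definition tame (C : R) (z : nat -> M) m :=
  forall j q, (j < m)%N -> between (z j) q (z j.+1) -> rho (z j) q <= C.

Definition coarse_geodesic (C : R) x y (w : nat -> M) m :=
  [/\ w 0 = x, w m = y, tame C w m & forall i j, (i <= j <= m)%N ->
      `|rho (w i) (w j) - (j%:R - i%:R)| <= C].

Hypothesis geoM : geodesic_space M.
Hypothesis prho : dominated_pseudometric.

Lemma between_rho_eq p v L : 0 <= L -> L <= rho p v ->
  exists2 p1, between p p1 v & rho p p1 = L.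
Proof.
case: prho => rho0 rhoC rhoT rhod L0 Lv.
have [c hc] := geodesic_pathP geoM p v.
have [t ht ct] : exists2 t, 0 <= t <= mdist p v & rho p (c t) = L.
  apply: ivt_lipschitz; rewrite ?mdist_ge0//.
    case: hc => _ _ cI s t hs ht; have := rhoT (c t) p (c s).
    by have := rhod (c t) (c s); rewrite cI// distrC; lra.
  case: hc => -> -> _; rewrite Lv andbT; apply: le_trans L0.
  by rewrite -(mdistxx p).
by exists (c t) => //; have [] := geodesic_path_between hc ht.
Qed.

End coarse_metric.

Lemma between_degenerate (R : realType) (M : metricType R) (x q : M) :
  between x q x -> q = x.
Proof.
rewrite /between mdistxx (metric_sym q) => h; apply/esym/mdist_positivity.
by have := mdist_ge0 x q; lra.
Qed.

Definition coarsely_geodesic (R : realType) (M : metricType R)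
    (rho : M -> M -> R) (C : R) :=
  forall x y, exists w m, coarse_geodesic rho C x y w m.

(* Let D be the supremum over the geodesic of the rho-distance to the chain z,
   and p an almost extremal point.  Points p1, p2 of the geodesic at rho-distance
   about 2 D on either side of p are joined, through the chain, by O(D) tame
   steps, which pass O(log D)-close to p.  They cannot do so between p1 or p2
   and the chain, hence D = O(log D). *)
Lemma geodesic_near_chain (R : realType) (delta C A : R) :
  0 <= delta -> 0 <= C -> 0 <= A -> exists2 D0, 0 <= D0 &
  forall (M : metricType R) (rho : M -> M -> R), geodesic_space M ->
  slim_space delta M -> dominated_pseudometric rho ->
  coarsely_geodesic rho C -> forall z m, tame rho C z m ->
  (forall i j, (i <= j <= m)%N -> j%:R - i%:R <= A * rho (z i) (z j) + A) ->
  forall p, between (z 0) p (z m) -> exists2 j, (j <= m)%N & rho p (z j) <= D0.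
Proof.
(* [a * D + b] adds two step counts: [D + 1 + C] for a leg from [p1] or [p2] to the chain, and
   [A * (6 * D + 2 * C + 8) + A] for the chain between the feet of the legs, which are at
   [rho]-distance at most [2 * L + 2 * (D + 1)]. *)
move=> d0 C0 A0; pose a := 6 * A + 1; pose b := A * (2 * C + 8) + A + 1 + C.
have a0 : 0 <= a by rewrite /a; lra.
have [D0 hD0] := log_growth_bound b (2 * delta + 2 * C + 1) a0 d0.
exists (`|D0| + 1) => [|M rho geo slim prho H2 z m tz Az p0 hp0].
  by rewrite addr_ge0.
have [rho0 rhoC rhoT rhod] := prho.
pose S := [set r | exists2 p, between (z 0) p (z m) &
  forall j, (j <= m)%N -> r <= rho p (z j)].
have S0 : S 0 by exists p0.
have supS : has_sup S.
  split; first by exists 0.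
  exists (mdist (z 0) (z m)) => r [p hp /(_ 0%N (leq0n _)) h].
  apply: le_trans h _; apply: le_trans (rhod _ _) _.
  by rewrite metric_sym; exact: between_le hp.
have ubS r : S r -> r <= sup S by move=> ?; apply: ub_le_sup; [exact: supS.2|].
set D := sup S in ubS; have D_ge0 : 0 <= D := ubS _ S0.
have near p : between (z 0) p (z m) ->
    exists2 j, (j <= m)%N & rho p (z j) <= D + 1.
  move=> hp; apply: contrapT => hn; suff /ubS : S (D + 1) by lra.
  exists p => // j jm; rewrite leNgt; apply/negP => h; apply: hn.
  by exists j => //; exact: ltW.
suff le_D : D <= D0.
  apply: contrapT => hn; suff /ubS : S (`|D0| + 1).
    by have := ler_norm D0; lra.
  exists p0 => // j jm; rewrite leNgt; apply/negP => h; apply: hn.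
  by exists j => //; exact: ltW.
have [r [p hp rp] lt_r] := sup_adherent (@ltr01 R) supS; rewrite -/D in lt_r.
apply: hD0 => n hn; pose L := 2 * D + C + 3.
have side v i : (i <= m)%N -> v = z i ->
    (forall p', between p p' v -> between (z 0) p' (z m)) ->
    exists p1 j, [/\ between p p1 v, (j <= m)%N, rho p p1 <= L,
      rho p1 (z j) <= D + 1 & p1 = z j \/ rho p p1 = L].
  move=> im vi hv; have [le_L|lt_L] := leP (rho p v) L.
    exists v, i; rewrite -vi; split=> //; first exact: between_r.
      by have := rhod v v; rewrite mdistxx; lra.
    by left.
  have [|p1 h1 e1] := between_rho_eq geo prho _ (ltW lt_L).
    by rewrite /L; lra.
  have [j jm hj] := near _ (hv _ h1).
  by exists p1, j; split=> //; [rewrite e1|right].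
have [|||p1 [j1 [b1 jm1 L1 D1 e1]]] := side (z 0) 0%N => //.
  by move=> p' /betweenC h; exact: (between_trans_l hp h).1.
have [|||p2 [j2 [b2 jm2 L2 D2 e2]]] := side (z m) m => //.
  by move=> p' /betweenC h; apply/betweenC;
    exact: (between_trans_l (betweenC hp) h).1.
have hb : between p1 p p2 := between_inner hp (betweenC b1) b2.
have leg p' j q : rho p' (z j) <= D + 1 -> p' = z j \/ rho p p' = L ->
    (j <= m)%N -> between p' q (z j) -> mdist p q <= 2 * delta ->
    D <= delta * n%:R + (2 * delta + 2 * C + 1).
  have dn0 : 0 <= delta * n%:R by rewrite mulr_ge0.
  move=> hD [->|hL] jm /[dup] hq.
    move=> /between_degenerate-> pq; have := rp j jm.
    by have := rhod p (z j); lra.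
  move=> _ pq; have [w [m' [w0 wm tw hw]]] := H2 p' (z j).
  have hm' : m'%:R <= rho p' (z j) + C.
    by have := hw 0%N m'; rewrite leqnn w0 wm => /(_ isT); rewrite ler_norml;
      lra.
  have m'n : (m' <= 2 ^ n)%N.
    rewrite -(ler_nat R) natrX; apply: le_trans hn; rewrite /a /b.
    have : 0 <= A * D by rewrite mulr_ge0.
    by have : 0 <= A * C by [rewrite mulr_ge0]; lra.
  have hq' : between (w 0) q (w m') by rewrite w0 wm.
  have [|i [q' [/andP[_ im'] hi hqq']]] := polygon_slim (n := n) slim d0 _ hq'.
    by rewrite add0n.
  have h1 : rho (w i) q' <= C.
    case: hi => [->|[hi hi']]; last exact: tw.
    by have := rhod (w i) (w i); rewrite mdistxx; lra.
  have h2 : rho p' (w i) <= i%:R + C.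
    have := hw 0%N i; rewrite w0 im' => /(_ isT).
    by rewrite ler_norml => /andP[_]; lra.
  have h3 : i%:R <= m'%:R :> R by rewrite ler_nat.
  have := rhoT q' p p'; have := rhoT (w i) p' q'; have := rhod p q'.
  have := metric_triangle p q q'; rewrite (rhoC p' q') hL /L.
  have : rho p' (w i) <= D + 1 + C + C by lra.
  lra.
have mid i j q : (i <= j <= m)%N ->
  j%:R - i%:R <= A * (6 * D + 2 * C + 8) + A ->
    between (z i) q (z j) -> mdist p q <= 2 * delta ->
    D <= delta * n%:R + (2 * delta + 2 * C + 1).
  move=> /andP[ij jm] hij hq pq.
  have [|l [q' [/andP[il lj] hl hqq']]] := polygon_slim (n := n) slim d0 _ hq.
    rewrite ij/= -(ler_nat R) natrD natrX -lerBlDl; apply: le_trans hn.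
    by rewrite /a /b; lra.
  have h1 : rho (z l) q' <= C.
    case: hl => [->|[hi hi']]; last exact/tz/hi'/(leq_trans hi).
    by have := rhod (z l) (z l); rewrite mdistxx; lra.
  have := rp l (leq_trans lj jm); have := rhoT q' p (z l);
    rewrite (rhoC q' (z l)).
  have := rhod p q'; have := metric_triangle p q q'; lra.
have step i j : (i <= j <= m)%N -> rho (z i) (z j) <= rho (z j1) (z j2) ->
    j%:R - i%:R <= A * (6 * D + 2 * C + 8) + A.
  move=> hij le_ij; apply: le_trans (Az _ _ hij) _; rewrite lerD2r ler_wpM2l//.
  apply: le_trans le_ij _; have := rhoT p1 (z j1) (z j2).
  have := rhoT p p1 (z j2); have := rhoT p2 p (z j2).
  by rewrite (rhoC (z j1) p1) (rhoC p1 p) /L in L1 L2 *; lra.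
(* Slimness of the quadrilateral [p1], [z j1], [z j2], [p2]: [p] is close to one of the two legs
   ([leg]) or to the side spanned by the chain ([mid]). *)
have [q [hq|hq] pq] := slim _ _ _ (z j1) hb.
  by apply: (leg p1 j1 q) => //; lra.
have [q' [hq'|hq'] qq'] := slim _ _ _ (z j2) hq; last first.
  apply: (leg p2 j2 q') => //; first exact: betweenC.
  by have := metric_triangle p q q'; lra.
have pq' : mdist p q' <= 2 * delta by have := metric_triangle p q q'; lra.
have [le_j|/ltnW le_j] := leqP j1 j2.
  by apply: (mid j1 j2 q') => //; rewrite ?le_j//; apply: step; rewrite ?le_j.
apply: (mid j2 j1 q'); rewrite ?le_j//; last exact: betweenC.
by apply: step; rewrite ?le_j// rhoC.
Qed.

Definition coarsely_monotone (R : realType) (M : metricType R)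
    (rho : M -> M -> R) (c : R) :=
  forall x p y : M, between x p y -> rho x p + rho p y <= rho x y + c.

(** [p] is [rho]-near some [w j], and [rho] is additive along [w]. In [c], the index comparisons
    account for [3 * C] and the replacement of [p] by [w j] for [2 * D]. *)
Lemma coarsely_geodesic_monotone (R : realType) (delta C : R) :
  0 <= delta -> 0 <= C -> exists2 c, 0 <= c &
  forall (M : metricType R) (rho : M -> M -> R), geodesic_space M ->
  slim_space delta M -> dominated_pseudometric rho ->
  coarsely_geodesic rho C -> coarsely_monotone rho c.
Proof.
move=> d0 C0; have A0 : 0 <= C + 1 by lra.
have [D D0 hD] := geodesic_near_chain d0 C0 A0.
exists (3 * C + 2 * D) => [|M rho geo slim prho H2 x p y hp]; first by lra.
have [rho0 rhoC rhoT rhod] := prho; have [w [m [w0 wm tw hw]]] := H2 x y.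
have [||j jm hj] := hD _ _ geo slim prho H2 w m tw _ p.
- move=> i j /hw; rewrite ler_norml => /andP[h1 h2].
  have : 0 <= C * rho (w i) (w j) by rewrite mulr_ge0.
  by lra.
- by rewrite w0 wm.
have := hw 0%N j; rewrite jm w0 => /(_ isT); rewrite ler_norml => /andP[_ h1].
have := hw j m; rewrite jm leqnn wm => /(_ isT);
  rewrite ler_norml => /andP[_ h2].
have := hw 0%N m; rewrite leqnn w0 wm => /(_ isT);
  rewrite ler_norml => /andP[h3 _].
have := rhoT (w j) x p; have := rhoT (w j) p y; rewrite (rhoC (w j) p).
by lra.
Qed.

(** * Discretized geodesics and stability of quasigeodesics *)

Section discretization.
Context {R : realType} {M : metricType R}.
Hypothesis geoM : geodesic_space M.

Lemma discretized_geodesic (x y : M) : exists (w : nat -> M) m,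
  [/\ w 0 = x, w m = y & forall i j, (i <= j <= m)%N ->
      `|mdist (w i) (w j) - (j%:R - i%:R)| <= 1].
Proof.
have [c [c0 cd cI]] := geodesic_pathP geoM x y.
set d := mdist x y in cd cI; have d0 : 0 <= d := mdist_ge0 _ _.
have hmin (t : R) : 0 <= t -> 0 <= Num.min t d <= d.
  by move=> t0; rewrite le_min t0 d0 ge_min lexx orbT.
(* The last sample lies beyond the length and is clamped to [d]; only the final step is shorter than
   1, which causes the error 1. *)
exists (fun j => c (Num.min j%:R d)), (Num.truncn d).+1; split.
- by rewrite min_l.
- by rewrite min_r ?cd//; exact/ltW/truncnS_gt.
move=> i j /andP[ij jm]; rewrite cI ?hmin//.
have ijR : i%:R <= j%:R :> R by rewrite ler_nat.
have jd : j%:R <= d + 1.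
  have /andP[h _] := truncn_itv d0;
    apply: le_trans (_ : (Num.truncn d).+1%:R <= _).
    by rewrite ler_nat.
  by rewrite -natr1 lerD2r.
rewrite ler_norml; case: (leP i%:R d) => hi; case: (leP j%:R d) => hj;
  rewrite ler0_norm; lra.
Qed.

Lemma mdist_dominated : dominated_pseudometric (@mdist R M).
Proof.
by split=> *; [exact: mdist_ge0|exact: metric_sym|exact: metric_triangle|].
Qed.

Lemma mdist_coarsely_geodesic C : 2 <= C -> coarsely_geodesic (@mdist R M) C.
Proof.
move=> C2 x y; have [w [m [w0 wm hw]]] := discretized_geodesic x y.
exists w, m; split=> //; last by move=> i j /hw; lra.
move=> j q jm /between_le; have := hw j j.+1; rewrite leqnSn jm => /(_ isT).
by rewrite -natr1 ler_norml; lra.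
Qed.

End discretization.

(** Morse lemma. [geodesic_near_chain] for the distance itself puts the geodesic near the chain.
    Conversely, its points near some [z i] with [i <= j] and those near some [z i'] with [j <= i']
    cover it; at a crossing [z i] and [z i'] are close, so [i' - i] is bounded and [z j] is near the
    crossing. *)
Lemma chain_near_geodesic (R : realType) (delta A : R) :
  0 <= delta -> 0 <= A -> exists2 H, 0 <= H &
  forall (M : metricType R), geodesic_space M -> slim_space delta M ->
  forall z : nat -> M,
  (forall i j, (i <= j)%N -> j%:R - i%:R <= A * mdist (z i) (z j) + A) ->
  (forall i j, (i <= j)%N -> mdist (z i) (z j) <= A * (j%:R - i%:R) + A) ->
  forall j m, (j <= m)%N ->
    exists2 p, between (z 0) p (z m) & mdist (z j) p <= H.
Proof.
move=> d0 A0; have C0 : 0 <= 2 * A + 2 by lra.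
have [D D0 hD] := geodesic_near_chain d0 C0 A0.
exists (A * (A * (2 * D + 1) + A) + A + D) => [|M geo slim z zl zu j m jm].
  by rewrite !(addr_ge0, mulr_ge0).
have tz : tame mdist (2 * A + 2) z m.
  move=> i q im /between_le; have := zu i i.+1 (leqnSn _); rewrite -natr1; lra.
have near p : between (z 0) p (z m) ->
    exists2 i, (i <= m)%N & mdist p (z i) <= D.
  apply: hD => //; first exact: mdist_dominated.
    by apply: mdist_coarsely_geodesic => //; lra.
  by move=> i i' /andP[/zl].
have [c hc] := geodesic_pathP geo (z 0) (z m).
pose P t := exists i, [/\ (i <= j)%N & mdist (c t) (z i) <= D].
pose Q t := exists i, [/\ (j <= i)%N & mdist (c t) (z i) <= D].
have [|||s [t [hs ht st [i [ij hi]] [i' [ij' hi']]]]] :=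
    @cover_crossing _ P Q _ (mdist_ge0 (z 0) (z m)).
- move=> t /(geodesic_path_between hc)[+ _] => /near[i im hi].
  by have [ij|/ltnW ij] := leqP i j; [left|right]; exists i.
- by exists 0%N; split=> //; case: hc => -> _ _; rewrite mdistxx.
- by exists m; split=> //; case: hc => _ -> _; rewrite mdistxx.
have [hcs _] := geodesic_path_between hc hs; exists (c s) => //.
have dst : mdist (c s) (c t) <= 1 by case: hc => _ _ ->.
have dii : mdist (z i) (z i') <= 2 * D + 1.
  have := metric_triangle (z i) (c s) (z i'); rewrite (metric_sym (z i) (c s)).
  by have := metric_triangle (c s) (c t) (z i'); lra.
have := zl i i' (leq_trans ij ij'); have := zu i j ij.
have jj : j%:R <= i'%:R :> R by rewrite ler_nat.
have := ler_wpM2l A0 dii => h1 h2 h3.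
have : A * (j%:R - i%:R) <= A * (A * (2 * D + 1) + A) by rewrite ler_wpM2l//;
  lra.
have := metric_triangle (z j) (z i) (c s).
rewrite (metric_sym (z j) (z i)) (metric_sym (z i) (c s)); lra.
Qed.

(** * Gromov products of a coarsely monotone pseudometric *)

Definition gprod (R : realType) (T : Type) (f : T -> T -> R) (p x y : T) : R :=
  (f x p + f y p - f x y) / 2.

(** The threshold [r] stands for the minimum of the two products. *)
Definition four_point (R : realType) (T : Type) (f : T -> T -> R) (C : R) :=
  forall p x y z r, r <= gprod f p x y -> r <= gprod f p y z ->
    r - C <= gprod f p x z.

Lemma mdist_monotone (R : realType) (M : metricType R) :
  coarsely_monotone (@mdist R M) 0.
Proof. by move=> ? ? ? ->; rewrite addr0. Qed.

Section gromov_products.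
Context {R : realType} {M : metricType R}.
Variables (rho : M -> M -> R) (delta c : R).
Hypothesis geoM : geodesic_space M.
Hypothesis slimM : slim_space delta M.
Hypothesis prho : dominated_pseudometric rho.
Hypothesis mrho : coarsely_monotone rho c.

Lemma gprod_le_dist p x q y : between x q y ->
  gprod rho p x y <= rho p q + c / 2.
Proof.
case: prho => _ rhoC rhoT _ /mrho.
rewrite /gprod; have := rhoT q x p; have := rhoT q y p.
by rewrite (rhoC q p) (rhoC y q); lra.
Qed.

(** By connectedness some [q] on the geodesic is near both [x, p] and [p, y], the latter up to the
    crossing gap 1. There coarse monotonicity makes [rho] almost additive along x, q, p and along p,
    q, y. *)
Lemma dist_le_gprod p x y : exists2 q, between x q y &
  rho p q <= gprod rho p x y + (c + 2 * delta + 1).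
Proof.
case: prho => _ rhoC rhoT rhod; have [g hg] := geodesic_pathP geoM x y.
pose P t := exists2 u, between x u p & mdist (g t) u <= delta.
pose Q t := exists2 u, between p u y & mdist (g t) u <= delta.
have d0 : 0 <= delta.
  by have [q _] := slimM x (between_l x x); apply: le_trans; exact: mdist_ge0.
have [|||s [t [hs ht st [u hu su] [v hv tv]]]] :=
    @cover_crossing _ P Q _ (mdist_ge0 x y).
- move=> t /(geodesic_path_between hg)[+ _] => /(slimM p)[q [hq|hq] ?];
    by [left; exists q|right; exists q].
- by exists x; [exact: between_l|case: hg => -> _ _; rewrite mdistxx].
- by exists y; [exact: between_r|case: hg => _ -> _; rewrite mdistxx].
have [hgs _] := geodesic_path_between hg hs; exists (g s) => //.
have dst : mdist (g s) (g t) <= 1 by case: hg => _ _ ->.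
have sv := metric_triangle (g s) (g t) v.
have := mrho hu; have := mrho hv.
have := rhod (g s) u; have := rhod (g s) v; set q := g s in su sv dst *.
have := rhoT u p q; have := rhoT v p q; have := rhoT u q x; have := rhoT v q y.
have := rhoT q x y; rewrite /gprod.
rewrite (rhoC u q) (rhoC u p) (rhoC u x) (rhoC v q) (rhoC q x) (rhoC y p); lra.
Qed.

(** Products are [rho]-distances to geodesics up to constants, and a point of [x, z] is
    [delta]-close to [x, y] or [y, z]. *)
Lemma coarsely_monotone_four_point :
  four_point rho (c + 2 * delta + 1 + delta + c / 2).
Proof.
move=> p x y z r hxy hyz; have [q hq pq] := dist_le_gprod p x z.
have [rho0 rhoC rhoT rhod] := prho.
have [q' [hq'|hq'] qq'] := slimM y hq; have := gprod_le_dist p hq';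
  have := rhoT q p q'; have := rhod q q'; lra.
Qed.

End gromov_products.

(** The subtracted term prevents a termwise comparison. Both products are controlled by the distance
    from [p] to one point [q] of the geodesic, and there [rho] is at most the distance. *)
Lemma gprod_le_gromov_product (R : realType) (M : metricType R) (rho : M ->
  M -> R)
    (delta c : R) p x y :
  geodesic_space M -> slim_space delta M -> dominated_pseudometric rho ->
  coarsely_monotone rho c ->
  gprod rho p x y <= gromov_product p x y + (2 * delta + 1 + c / 2).
Proof.
move=> geo slim prho mrho.
have [q hq pq] :=
  dist_le_gprod geo slim (@mdist_dominated _ M) (@mdist_monotone _ M) p x y.
have := gprod_le_dist prho mrho p hq; case: prho => _ _ _ /(_ p q).
have -> : gromov_product p x y = gprod mdist p x y by [].
lra.
Qed.

(** * The boundary of a space with the four-point condition *)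

Section gromov_product_lemmas.
Context {R : realType} {M : metricType R}.
Implicit Types (p x y : M) (u v w : nat -> M).

Lemma gromov_productC p x y : gromov_product p x y = gromov_product p y x.
Proof. by rewrite /gromov_product (addrC (mdist x p)) (metric_sym x y). Qed.

Lemma gromov_product_base p p' x y :
  gromov_product p x y <= gromov_product p' x y + mdist p p'.
Proof.
rewrite /gromov_product (metric_sym p p').
have := metric_triangle x p' p; have := metric_triangle y p' p; lra.
Qed.

Lemma gromov_product_shift p x y x' y' :
  gromov_product p x y <= gromov_product p x' y' + mdist x x' + mdist y y'.
Proof.
rewrite /gromov_product; have := metric_triangle x x' p.
have := metric_triangle y y' p; have := metric_triangle x' x y'.
have := metric_triangle x y y'; rewrite (metric_sym x' x); lra.
Qed.

Lemma gromov_product_le_dist p x y : gromov_product p x y <= mdist p x.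
Proof.
rewrite /gromov_product (metric_sym p x); have := metric_triangle y x p.
by rewrite (metric_sym y x); lra.
Qed.

Lemma near_prod_infty (P : nat -> nat -> Prop) :
  (\forall k \near filter_prod \oo \oo, P k.1 k.2) <->
  exists N, forall m n, (N <= m)%N -> (N <= n)%N -> P m n.
Proof.
split=> [[[A B] /= [[N1 _ h1] [N2 _ h2]] hP]|[N hN]].
  exists (maxn N1 N2) => m n; rewrite !geq_max => /andP[m1 _] /andP[_ n2].
  by apply: (hP (m, n)); split=> /=; [exact: h1|exact: h2].
exists ([set m | (N <= m)%N], [set m | (N <= m)%N]) => /=.
  by split; exists N.
by move=> [m n] /= [] *; apply: hN.
Qed.

Lemma gromov_divergeP u v p : gromov_diverge u v <->
  forall r, exists N, forall m n, (N <= m)%N -> (N <= n)%N ->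
    r <= gromov_product p (u m) (v n).
Proof.
split=> [h r|h q].
  have /cvgryPge/(_ r) := h p.
  exact: (near_prod_infty (fun m n => r <= gromov_product p (u m) (v n))).1.
apply/cvgryPge => r.
apply/(near_prod_infty (fun m n => r <= gromov_product q (u m) (v n))).
have [N hN] := h (r + mdist p q); exists N => m n Nm Nn.
by have := hN m n Nm Nn; have := gromov_product_base p q (u m) (v n); lra.
Qed.

Lemma gromov_divergeC u v : gromov_diverge u v -> gromov_diverge v u.
Proof.
move=> h; apply/(gromov_divergeP _ _ (u 0)) => r.
have /(gromov_divergeP _ _ (u 0))/(_ r)[N hN] := h; exists N => m n Nm Nn.
by rewrite gromov_productC; exact: hN.
Qed.

Variable C : R.
Hypothesis fourM : four_point (@mdist R M) C.

Lemma gromov_product_four p x y z r : r <= gromov_product p x y ->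
  r <= gromov_product p y z -> r - C <= gromov_product p x z.
Proof. exact: fourM. Qed.

Lemma gromov_diverge_trans u v w :
  gromov_diverge u v -> gromov_diverge v w -> gromov_diverge u w.
Proof.
move=> /(gromov_divergeP _ _ (u 0)) h1 /(gromov_divergeP _ _ (u 0)) h2.
apply/(gromov_divergeP _ _ (u 0)) => r.
have [N1 hN1] := h1 (r + C); have [N2 hN2] := h2 (r + C).
exists (maxn N1 N2) => m n; rewrite !geq_max => /andP[m1 m2] /andP[n1 n2].
have := gromov_product_four (hN1 m m m1 m1) (hN2 m n m2 n2).
by rewrite addrK.
Qed.

Definition bdry_of u (h : gromov_diverge u u) : gromov_boundary M :=
  @GromovBoundary R M [set v | gromov_diverge v v /\ gromov_diverge u v]
    (ex_intro2 (fun w => gromov_diverge w w) _ u h erefl).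

Lemma bdry_ofP u (h : gromov_diverge u u) : bdry_class (bdry_of h) u.
Proof. by []. Qed.

Implicit Types xi eta : gromov_boundary M.

Lemma bdry_diverge xi u v : bdry_class xi u -> bdry_class xi v ->
  gromov_diverge u v.
Proof.
have [w _ ->] := bdry_classP xi => -[_ /gromov_divergeC h1] [_ h2].
exact: gromov_diverge_trans h1 h2.
Qed.

Lemma bdry_ex xi : exists u, bdry_class xi u.
Proof. by have [w h ->] := bdry_classP xi; exists w. Qed.

Lemma diverge_bdry xi u v : bdry_class xi u -> gromov_diverge u v ->
  bdry_class xi v.
Proof.
have [w _ ->] := bdry_classP xi => -[_ h1] h2; split.
  exact: gromov_diverge_trans (gromov_divergeC h2) h2.
exact: gromov_diverge_trans h1 h2.
Qed.

Lemma bdry_eq xi eta u v : bdry_class xi u -> bdry_class eta v ->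
  gromov_diverge u v -> xi = eta.
Proof.
move=> xu ev uv.
have : bdry_class xi = bdry_class eta.
  apply/seteqP; split=> w hw.
    apply: (diverge_bdry ev);
      apply: gromov_diverge_trans (gromov_divergeC uv) _.
    exact: bdry_diverge xu hw.
  apply: (diverge_bdry xu); apply: gromov_diverge_trans uv _.
  exact: bdry_diverge ev hw.
case: xi eta {xu ev} => [A hA] [B hB] /= eAB; move: hA hB; rewrite eAB => hA hB.
by congr GromovBoundary; exact: Prop_irrelevance.
Qed.

(** The supremum only provides some representatives [u'], [v']. Passing through [u m], [u' m],
    [v' m], [v n] uses the four-point condition twice, whence [2 * C]. *)
Lemma lt_bdry_product p xi eta r u v : (r%:E < bdry_product p xi eta)%E ->
  bdry_class xi u -> bdry_class eta v -> exists N, forall m n, (N <= m)%N ->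
    (N <= n)%N ->
    r - 2 * C <= gromov_product p (u m) (v n).
Proof.
move=> /ereal_sup_gt[_ [u' xu' [v' ev' <-]]]; rewrite limf_einfE.
move=> /ereal_sup_gt[_ [V FV <-]] hr xu ev.
have /(near_prod_infty (fun m n =>
  r <= gromov_product p (u' m) (v' n)))[N0 hN0] :
    \forall k \near filter_prod \oo \oo,
      r <= gromov_product p (u' k.1) (v' k.2).
  apply: filterS FV => k Vk; rewrite -lee_fin; apply: le_trans (ltW hr) _.
  by apply: ereal_inf_lbound; exists k.
have /(gromov_divergeP _ _ p)/(_ r)[N1 hN1] := bdry_diverge xu xu'.
have /(gromov_divergeP _ _ p)/(_ (r - C))[N2 hN2] := bdry_diverge ev' ev.
exists (maxn N0 (maxn N1 N2)) => m n; rewrite !geq_max.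
move=> /and3P[m0 m1 m2] /and3P[n0 n1 n2].
have h := gromov_product_four (hN1 m m m1 m1) (hN0 m m m0 m0).
have := gromov_product_four h (hN2 m n m2 n2).
by lra.
Qed.

Lemma le_bdry_product p xi eta r u v : bdry_class xi u -> bdry_class eta v ->
  (exists N, forall m n, (N <= m)%N -> (N <= n)%N ->
    r <= gromov_product p (u m) (v n)) -> (r%:E <= bdry_product p xi eta)%E.
Proof.
move=> xu ev.
move=> /(near_prod_infty (fun m n => r <= gromov_product p (u m) (v n))) hN.
apply: le_trans (_ : limf_einf (fun k : nat * nat =>
  (gromov_product p (u k.1) (v k.2))%:E) (filter_prod \oo \oo) <= _)%E;
    last first.
  by apply: ereal_sup_ubound; exists u => //; exists v.
rewrite limf_einfE; apply: le_trans (ereal_sup_ubound _); last by eexists;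
  [exact: hN|].
by apply/ereal_infP => _ [k hk <-]; rewrite lee_fin.
Qed.

End gromov_product_lemmas.

(** * The distance of the coned-off space *)

Section hops.
Context {R : realType} {X : metricType R} {I : Type} (B : I -> set X).

(* [hops n x y l]: a path from x to y made of n jumps inside members of B and of
   steps in X of total length l; in the coned-off space it has length
   l + 2 n. *)
Inductive hops : nat -> X -> X -> R -> Prop :=
| hops0 x y : hops 0 x y (mdist x y)
| hopsS i x a b y n l : B i a -> B i b -> hops n b y l ->
    hops n.+1 x y (mdist x a + l).

Lemma hops_ge0 n x y l : hops n x y l -> 0 <= l.
Proof.
by elim=> [x' y'|i x' a b y' m l' _ _ _ IH]; rewrite ?addr_ge0 ?mdist_ge0.
Qed.

Lemma hops_shift n x y l x' : hops n x y l ->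
  exists2 l', hops n x' y l' & l' <= mdist x' x + l.
Proof.
case=> [x1 y1|i x1 a b y1 m l1 Ba Bb h].
  by exists (mdist x' y1); [exact: hops0|exact: metric_triangle].
exists (mdist x' a + l1); first exact: hopsS Ba Bb h.
by rewrite addrA lerD2r metric_triangle.
Qed.

Hypothesis B0 : forall i, B i !=set0.

(* The infimum J of l + 2 n over the paths to y extends to a potential on the
   coned-off space. *)
Lemma cone_dist_hops x y : exists n l,
  hops n x y l /\ l + 2 * n%:R <= cone_dist (Base B x) (Base B y) + 1.
Proof.
pose S z := [set r | exists n l, hops n z y l /\ r = l + 2 * n%:R].
have S_ge0 z r : S z r -> 0 <= r.
  by move=> [n [l [/hops_ge0 h ->]]]; rewrite addr_ge0// mulr_ge0.
have infS z : has_inf (S z).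
  split; last by exists 0 => r /S_ge0.
  by exists (mdist z y + 2 * 0%:R), 0%N, (mdist z y); split=> //; exact: hops0.
pose J z := inf (S z).
have J_le z r : S z r -> J z <= r by move=> h; apply: ge_inf => //;
  exact: (infS z).2.
have J_ge z r : (forall r', S z r' -> r <= r') -> r <= J z.
  by move=> h; apply: lb_le_inf => //; exact: (infS z).1.
have J0 z : 0 <= J z by apply: J_ge => r /S_ge0.
have JL z z' : J z' - J z <= mdist z z'.
  rewrite lerBlDl -lerBlDr;
    apply: J_ge => r [n [l [/(hops_shift z')[l' h' le_l]] ->]].
  have : J z' <= l' + 2 * n%:R by apply: J_le; exists n, l'.
  by rewrite (metric_sym z z'); lra.
have Jhop i a b : B i a -> B i b -> J a <= J b + 2.
  move=> Ba Bb; rewrite -lerBlDr; apply: J_ge => r [n [l [h ->]]].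
  have : J a <= l + 2 * n.+1%:R.
    apply: J_le; exists n.+1, (mdist a a + l); rewrite {2}mdistxx add0r.
    by split=> //; exact: hopsS Ba Bb h.
  by rewrite -natr1; lra.
pose Jc i := inf [set J b | b in B i].
have infJc i : has_inf [set J b | b in B i].
  split; first by have [b Bb] := B0 i; exists (J b), b.
  by exists 0 => _ [b _ <-].
have Jc_le i b : B i b -> Jc i <= J b.
  by move=> h; apply: ge_inf; [exact: (infJc i).2|exists b].
have Jc_ge i a : B i a -> J a - 2 <= Jc i.
  move=> Ba; apply: lb_le_inf; first exact: (infJc i).1.
  by move=> _ [b Bb <-]; have := Jhop _ _ _ Ba Bb; lra.
have foot (e : cone_edge B) : B (projT1 e) (edge_foot e) by exact: set_valP.
(* Potential inside an edge, reached from the foot or through the apex. Since [J] varies by at most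
   2 on each [B i], the minimum is [J] at the foot and [Jc + 1] at the apex. *)
pose fe (e : cone_edge B) t :=
  Num.min (J (edge_foot e) + t) (Jc (projT1 e) + 1 + (1 - t)).
have := @cone_potential_dist _ _ _ B B0 J fe (fun i =>
  Jc i + 1) (Base B y) (Base B x).
rewrite (cone_dist_sym (Base B y)) /= => H.
have {H} : J x - J y <= cone_dist (Base B x) (Base B y).
  apply: H => [e|e|//|e s t hs ht]; rewrite /fe.
  - by rewrite addr0 min_l//; have := Jc_ge _ _ (foot e); lra.
  - by rewrite min_r; have := Jc_le _ _ (foot e); lra.
  - have := ler_norm (s - t); have := ler_norm (t - s); rewrite (distrC t s).
    by rewrite !minEle; case: ifP => h1; case: ifP => h2; lra.
have : J y <= 0.
  by apply: J_le; exists 0%N, (mdist y y); split;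
    [exact: hops0|rewrite mdistxx mulr0 addr0].
have [_ [n [l [h ->]]] lt_l] := inf_adherent (@ltr01 R) (infS x).
by exists n, l; split=> //; rewrite /J in lt_l *; lra.
Qed.

End hops.

Section coned_off_metric.
Context {R : realType} {X : metricType R} {I : Type} {B : I -> set X}.
Variable B0 : forall i, B i !=set0.

Definition cone_rho (x y : X) : R := mdist (cone_incl B0 x) (cone_incl B0 y).

Lemma cone_rho_dominated : dominated_pseudometric cone_rho.
Proof.
split=> [x y|x y|y x z|x y]; first exact: mdist_ge0.
- exact: metric_sym.
- exact: metric_triangle.
- by apply: cone_dist_le; apply: cone_chain_step; exact: StepBase.
Qed.

Lemma mdist_edge_at (e : cone_edge B) t : 0 <= t <= 1 ->
  mdist (cone_incl B0 (edge_foot e)) (edge_at e t : coned_off B0) <= t.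
Proof.
move=> ht; apply: le_trans (_ : `|0 - t| <= _); last first.
  by rewrite sub0r normrN ger0_norm//; case/andP: ht.
apply: cone_dist_le; rewrite /cone_incl -edge_at0; apply: cone_chain_step.
by apply: StepEdge => //; rewrite lexx ler01.
Qed.

Lemma mdist_apex i a : B i a ->
  mdist (cone_incl B0 a) (Apex B i : coned_off B0) <= 1.
Proof.
move=> Ba; pose e : cone_edge B := existT _ i (SigSub (mem_set Ba)).
have := @mdist_edge_at e 1; rewrite edge_at1 ler01 lexx; exact.
Qed.

Lemma cone_incl_dense (p : coned_off B0) : exists x,
  mdist p (cone_incl B0 x) <= 1.
Proof.
case: p => [x|e t|i].
- by exists x; rewrite mdistxx.
- exists (edge_foot e); rewrite metric_sym -edge_at_val.
  have /andP[t0 t1] := valP t; apply: le_trans (ltW t1); apply: mdist_edge_at.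
  by rewrite !ltW.
- by have [a Ba] := B0 i; exists a; rewrite metric_sym; exact: mdist_apex.
Qed.

Lemma cone_rho_common i a b : B i a -> B i b -> cone_rho a b <= 2.
Proof.
move=> Ba Bb; have ha := mdist_apex Ba; have := mdist_apex Bb.
rewrite metric_sym /cone_rho => hb; apply: le_trans (metric_triangle _ _ _) _.
by rewrite (_ : 2 = 1 + 1)//; exact: lerD ha hb.
Qed.

Variables (delta k : R).
Hypotheses (k0 : 0 <= k) (d0 : 0 <= delta).
Hypothesis geoX : geodesic_space X.
Hypothesis slimX : slim_space delta X.
Hypothesis qcB : forall i, quasiconvex k (B i).
Hypothesis geoC : geodesic_space (coned_off B0).

Lemma quasiconvex_between i a q b : B i a -> B i b -> between a q b ->
  exists2 b', B i b' & mdist q b' <= k.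
Proof.
by move=> Ba Bb /(between_segment geoX)[S hS Sq]; exact: qcB Ba Bb hS _ Sq.
Qed.

(** In the quadrilateral [x], [a], [b], [y], the point [p] is close to [x, a], to [a, b], or to
    [b, y], where the induction applies. Each hop costs [2 + 2 * delta]; [k] is paid once, when [p]
    is near [a, b]. *)
Lemma hops_between n x y l p : hops B n x y l -> between x p y ->
  cone_rho x p <= l + 2 * n%:R + k + 2 * delta * n%:R.
Proof.
have [rho0 rhoC rhoT rhod] := cone_rho_dominated; have [hk hd] := (k0, d0).
have k20 : 0 <= k + 2 * delta * n%:R by rewrite addr_ge0// mulr_ge0// mulr_ge0.
move=> h; elim: h p k20 => {n x y l} [x y|i x a b y n l Ba Bb h IH] p k20 hp.
  rewrite !mulr0 !addr0 in k20 *; have := between_le hp; have := rhod x p; lra.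
have {}IH p' : between b p' y ->
  cone_rho b p' <= l + 2 * n%:R + k + 2 * delta * n%:R.
  by apply: IH; rewrite addr_ge0// mulr_ge0// mulr_ge0.
have l0 := hops_ge0 h; have n0 : 0 <= n%:R :> R by [].
have dn0 : 0 <= delta * n%:R by rewrite mulr_ge0.
have rxa := rhod x a; have rab := cone_rho_common Ba Bb.
have -> : n.+1%:R = n%:R + 1 :> R by rewrite natr1.
have [q [hq|hq] pq] := slimX a hp.
  have := rhoT q x p; have := rhod q p; rewrite (metric_sym q p).
  by have := rhod x q; have := between_le hq; lra.
have [q' [hq'|hq'] qq'] := slimX b hq; have tq := metric_triangle p q q'.
  have [b' Bb' qb'] := quasiconvex_between Ba Bb hq'.
  have := metric_triangle p q' b'; have := rhoT b' x p; have := rhod b' p.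
  have := cone_rho_common Ba Bb'; have := rhoT a x b';
    rewrite (metric_sym b' p).
  by lra.
have := IH _ hq'; have := rhoT a x q'; have := rhoT b a q'.
by have := rhoT q' x p; have := rhod q' p; rewrite (metric_sym q' p); lra.
Qed.

(** A coned-off geodesic is sampled and its points moved into [X]. Consecutive points are then at
    [rho]-distance at most 4, so some path between them has [l + 2 * n%:R <= 5], hence at most two
    hops, and [hops_between] gives the constant. *)
Lemma cone_rho_coarsely_geodesic :
  coarsely_geodesic cone_rho (5 + k + 4 * delta).
Proof.
have [rho0 rhoC rhoT rhod] := cone_rho_dominated; have [hk hd] := (k0, d0).
move=> x y; have [w [m [w0 wm hw]]] :=
  discretized_geodesic geoC (cone_incl B0 x) (cone_incl B0 y).
(* The ends have to be exactly [x] and [y]. For [m = 0] both are prescribed at the same index, and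
   injectivity of [Base] makes them agree. *)
have /choice[v hv] : forall j, exists v, mdist (w j) (cone_incl B0 v) <= 1 /\
    (j = 0%N -> v = x) /\ (j = m -> w j = cone_incl B0 y -> v = y).
  move=> j; have [[ej|nj0] [ej'|njm]] := (pselect (j = 0%N), pselect (j = m)).
  - exists x; rewrite ej w0 mdistxx; split=> //; split=> // _.
    by rewrite /cone_incl => -[].
  - by exists x; rewrite ej w0 mdistxx; split=> //; split=> // e; case: njm;
      rewrite ej.
  - by exists y; rewrite ej' wm mdistxx; split=> //; split=> // e; case: nj0;
      rewrite ej'.
  - have [v hv] := cone_incl_dense (w j); exists v.
    by split=> //; split=> [/nj0|/njm].
have vw i j : (i <= j <= m)%N -> `|cone_rho (v i) (v j) - (j%:R - i%:R)| <= 3.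
  move=> /hw; have [hi _] := hv i; have [hj _] := hv j.
  have := metric_triangle (cone_incl B0 (v i)) (w i) (cone_incl B0 (v j)).
  have := metric_triangle (w i) (w j) (cone_incl B0 (v j)).
  have := metric_triangle (w i) (cone_incl B0 (v i)) (w j).
  have := metric_triangle (cone_incl B0 (v i)) (cone_incl B0 (v j)) (w j).
  rewrite (metric_sym (cone_incl B0 (v i)) (w i)).
  rewrite (metric_sym (cone_incl B0 (v j)) (w j)) /cone_rho !ler_norml.
  by move=> h1 h2 h3 h4 /andP[h5 h6]; apply/andP; split; lra.
exists v, m; split.
- by have [_ [h _]] := hv 0%N; exact: h.
- by have [_ [_ h]] := hv m; exact: h.
- move=> j q jm hq; have [n [l [hn hl]]] := cone_dist_hops B0 (v j) (v j.+1).
  have : cone_rho (v j) (v j.+1) <= 4.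
    have := vw j j.+1; rewrite leqnSn jm => /(_ isT).
    by rewrite -natr1 ler_norml; lra.
  rewrite /cone_rho => h4; have := hops_between hn hq; have := hops_ge0 hn.
  move=> l0 hq'; have n2 : n%:R <= 2 :> R.
    by rewrite (ler_nat R n 2) -ltnS -(ltr_nat R); rewrite /cone_rho in h4; lra.
  have := ler_wpM2l hd n2; rewrite /cone_rho in h4 hq' *; lra.
- by move=> i j /vw; lra.
Qed.
End coned_off_metric.

(** * Geodesic rays seen in the coned-off space *)

Section coned_off_hyperbolic.
Context {R : realType} {X : metricType R} {I : Type} {B : I -> set X}.
Variable B0 : forall i, B i !=set0.

Lemma cone_incl_ray (gamma : R -> X) t : 0 <= t ->
  (cone_incl B0 @` ray_image gamma) (cone_incl B0 (gamma t)).
Proof.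
by move=> t0; exists (gamma t) => //; exists t => //; rewrite /= in_itv/= andbT.
Qed.

Lemma unbounded_ray (gamma : R -> X) (x : X) :
  ~ bounded_subset (cone_incl B0 @` ray_image gamma) ->
  forall L, exists2 t, 0 <= t & L <= cone_rho B0 x (gamma t).
Proof.
move=> nb L; apply: contrapT => h; apply: nb; exists (L + L).
have hL t : 0 <= t -> cone_rho B0 x (gamma t) <= L.
  by move=> t0; rewrite leNgt; apply/negP => /ltW hL; apply: h; exists t.
move=> _ _ [_ [s hs <-] <-] [_ [t ht <-] <-];
  apply: le_trans (metric_triangle _ (cone_incl B0 x) _) _.
rewrite metric_sym; apply: lerD; apply: hL.
  by move: hs; rewrite /= in_itv/= andbT.
by move: ht; rewrite /= in_itv/= andbT.
Qed.

Section geodesic_rays.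
Variable c : R.
Hypothesis mrho : coarsely_monotone (cone_rho B0) c.
Variable gamma : R -> X.
Hypothesis ray_gamma : geodesic_ray gamma.
Hypothesis unb_gamma : ~ bounded_subset (cone_incl B0 @` ray_image gamma).

Let f t := cone_rho B0 (gamma 0) (gamma t).

Lemma geodesic_rayE s t : 0 <= s -> s <= t -> mdist (gamma s) (gamma t) = t - s.
Proof.
move=> s0 st; rewrite ray_gamma /= ?in_itv/= ?andbT ?(le_trans s0)//.
by rewrite distrC ger0_norm// subr_ge0.
Qed.

Lemma geodesic_ray_between s t : 0 <= s -> s <= t ->
  between (gamma 0) (gamma s) (gamma t).
Proof.
move=> s0 st; rewrite /between !geodesic_rayE ?(le_trans s0 st)//.
by rewrite !subr0 addrC subrK.
Qed.

Let f_monotone s t : 0 <= s -> s <= t ->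
  f s + cone_rho B0 (gamma s) (gamma t) <= f t + c.
Proof. by move=> s0 st; apply/mrho/geodesic_ray_between. Qed.

Lemma geodesic_ray_shadow : exists beta : R -> coned_off B0,
  [/\ quasigeodesic_ray_with (`|c| + 1) beta, beta 0 = cone_incl B0 (gamma 0)
    & (hausdorff_dist (cone_incl B0 @` ray_image gamma)
         (ray_image beta) <= (`|c|)%:E)%E].
Proof.
have [rho0 rhoC rhoT rhod] := cone_rho_dominated B0.
have cc := ler_norm c; have c0 := normr_ge0 c.
(* [T s] is a time at which [gamma] is at [rho]-distance [s] from its start; [T] may fail to be
   monotone. *)
have /choice[T hT] : forall s, exists t, 0 <= s -> 0 <= t /\ f t = s.
  move=> s; have [s0|s0] := leP 0 s; last by exists 0.
  have [b b0 hb] := unbounded_ray (gamma 0) unb_gamma s.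
  have [|//||t /andP[t0 _] ht] := @ivt_lipschitz _ f b s; last by exists t.
    move=> u v /andP[u0 _] /andP[v0 _];
      have := rhoT (gamma v) (gamma 0) (gamma u).
    have := rhod (gamma v) (gamma u); have := geodesic_rayE.
    rewrite /f; have [uv|/ltW uv] := leP u v.
      by rewrite metric_sym => /(_ _ _ u0 uv) -> *; rewrite ler0_norm; lra.
    by move=> /(_ _ _ v0 uv) -> *; rewrite ger0_norm; lra.
  by rewrite /f /cone_rho mdistxx s0.
(* The order of the times is left free because of [T]: if [t < s] although [f s <= f t], coarse
   monotonicity bounds the distance by [c]. *)
have upper s t : 0 <= s -> 0 <= t -> f s <= f t ->
    cone_rho B0 (gamma s) (gamma t) <= f t - f s + `|c|.
  move=> s0 t0 fst; have [st|/ltW ts] := leP s t.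
    by have := f_monotone s0 st; lra.
  by have := f_monotone t0 ts; rewrite rhoC; lra.
exists (cone_incl B0 \o gamma \o T); split.
- split; first by lra.
  have bound s t : 0 <= s -> s <= t ->
      t - s <= cone_rho B0 (gamma (T s)) (gamma (T t)) <= t - s + `|c|.
    move=> s0 st; have [[Ts0 fs] [Tt0 ft]] := (hT s s0, hT t (le_trans s0 st)).
    apply/andP; split; last first.
      by have := upper _ _ Ts0 Tt0; rewrite fs ft; exact.
    by have := rhoT (gamma (T s)) (gamma 0) (gamma (T t)); rewrite /f in fs ft;
      lra.
  have {bound} bound s t : 0 <= s -> 0 <= t ->
      `|s - t| <= cone_rho B0 (gamma (T s)) (gamma (T t)) <= `|s - t| + `|c|.
    move=> s0 t0; have [st|/ltW st] := leP s t.
      by rewrite distrC ger0_norm ?subr_ge0// bound.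
    by rewrite rhoC ger0_norm ?subr_ge0// bound.
  move=> s t s0 t0; have /andP[h1 h2] := bound s t s0 t0.
  have n0 := normr_ge0 (s - t); rewrite /= -/(cone_rho B0 _ _); apply/andP;
    split.
    apply: le_trans h1; rewrite lerBlDr ler_wpDr ?addr_ge0//.
    by rewrite ler_piMl// invf_le1; lra.
  apply: le_trans h2 _; have : 0 <= `|c| * `|s - t| by rewrite mulr_ge0.
  by lra.
- by apply/esym/mdist_positivity; exact: (hT 0 (lexx 0)).2.
apply: ereal_inf_lbound; exists `|c| => //; split=> //.
- move=> _ [_ [t + <-] <-]; rewrite /= in_itv/= andbT => t0.
  (* [t] and [T (f t)] have the same value under [f], so [upper] places the two points within
     [|c|]. *)
  have [Tt0 ft] := hT (f t) (rho0 _ _).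
  exists (cone_incl B0 (gamma (T (f t)))).
    by exists (f t) => //; rewrite /= in_itv/= andbT; exact: rho0.
  rewrite -/(cone_rho B0 _ _); have := upper _ _ t0 Tt0;
    rewrite ft lexx subrr add0r; exact.
- move=> _ [s + <-]; rewrite /= in_itv/= andbT => s0.
  exists (cone_incl B0 (gamma (T s))); last by rewrite mdistxx.
  exists (gamma (T s)) => //; exists (T s) => //.
  by rewrite /= in_itv/= andbT; exact: (hT s s0).1.
Qed.

(** Coarse monotonicity prevents the ray from returning: having reached [rho]-distance [r + 2 * |c|]
    from its start, it stays beyond [r + |c|], and products of later points are at least [r]. *)
Lemma geodesic_ray_cone_diverge :
  gromov_diverge (fun n => cone_incl B0 (gamma n%:R)) (fun n =>
    cone_incl B0 (gamma n%:R)).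
Proof.
have [rho0 rhoC rhoT rhod] := cone_rho_dominated B0.
apply/(gromov_divergeP _ _ (cone_incl B0 (gamma 0))) => r.
have [t0 t00 ht0] := unbounded_ray (gamma 0) unb_gamma (r + 2 * `|c|).
have far t : t0 <= t -> r + `|c| <= f t.
  move=> ht; have := f_monotone t00 ht; have := rho0 (gamma t0) (gamma t).
  by have := ler_norm c; rewrite /f; lra.
have cc := ler_norm c; have c0 := normr_ge0 c.
have key s t : t0 <= s -> s <= t ->
  r <= gprod (cone_rho B0) (gamma 0) (gamma s) (gamma t).
  move=> h1 h2; have := f_monotone (le_trans t00 h1) h2; have := far _ h1.
  rewrite /gprod (rhoC (gamma s) (gamma 0)) (rhoC (gamma t) (gamma 0)) /f.
  by lra.
exists (Num.truncn t0).+1 => m n hm hn.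
have large i : ((Num.truncn t0).+1 <= i)%N -> t0 <= i%:R.
  by move=> hi; apply: le_trans (ltW (truncnS_gt t0)) _; rewrite ler_nat.
have [mn|/ltnW nm] := leqP m n; last rewrite gromov_productC.
  by apply: key; [exact: large|rewrite ler_nat].
by apply: key; [exact: large|rewrite ler_nat].
Qed.

End geodesic_rays.

Lemma geodesic_ray_diverge (gamma : R -> X) : geodesic_ray gamma ->
  gromov_diverge (fun n => gamma n%:R) (fun n => gamma n%:R).
Proof.
move=> hg; apply/(gromov_divergeP _ _ (gamma 0)) => r.
exists (Num.truncn r).+1 => m n hm hn.
have large i : ((Num.truncn r).+1 <= i)%N -> r <= i%:R.
  by move=> hi; apply: le_trans (ltW (truncnS_gt r)) _; rewrite ler_nat.
have key i j : ((Num.truncn r).+1 <= i)%N -> (i <= j)%N ->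
    r <= gromov_product (gamma 0) (gamma i%:R) (gamma j%:R).
  move=> hi ij; rewrite /gromov_product !(metric_sym _ (gamma 0)).
  have ijR : i%:R <= j%:R :> R by rewrite ler_nat.
  by rewrite !(geodesic_rayE hg)//; have := large _ hi; lra.
by have [mn|/ltnW nm] := leqP m n; last rewrite gromov_productC; apply: key.
Qed.

End coned_off_hyperbolic.

(** * Rays representing boundary points *)

Section quasigeodesic_representative.
Context {R : realType} {M : metricType R}.
Variable C : R.
Hypothesis geoM : geodesic_space M.
Hypothesis fourM : four_point (@mdist R M) C.

Lemma between_gromov_product (p a x : M) : between p a x ->
  gromov_product p a x = mdist p a.
Proof.
by rewrite /between /gromov_product (metric_sym a p) (metric_sym x p) => <-;
  lra.
Qed.

(** No limit of geodesics is taken: [gamma s] lies at distance [s] on a geodesic [p, x N] with [N]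
    depending on [s]. For [s <= t], [gamma s] and [gamma t] both have product at least [s - C] with
    a common [x m], so their own product is at least [s - 2 * C] and their distance at most
    [t - s + 4 * |C|]. *)
Lemma quasigeodesic_ray_exists (x : nat -> M) : gromov_diverge x x ->
  exists2 gamma : R -> M, quasigeodesic_ray gamma &
    gromov_diverge x (fun n => gamma n%:R).
Proof.
move=> divx; pose p := x 0%N; have C_le := ler_norm C.
have four := gromov_product_four fourM.
have /choice[gamma hg] : forall s, exists a, 0 <= s -> mdist p a = s /\
    exists N, forall m, (N <= m)%N -> s - C <= gromov_product p a (x m).
  move=> s; have [s0|s0] := leP 0 s; last by exists p; lra.
  have /(gromov_divergeP _ _ p)/(_ s)[N hN] := divx.
  have sN : s <= mdist p (x N).
    by apply: le_trans (gromov_product_le_dist _ _ _); exact: hN.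
  have [|a ha pa] := between_exists geoM (x := p) (y := x N) (t := s).
    by rewrite s0.
  exists a => _; split=> //; exists N => m hm; apply: (four _ _ (x N)).
    by rewrite between_gromov_product// pa.
  exact: hN.
have c0 := normr_ge0 C.
exists gamma.
  exists (4 * `|C| + 1); split; first by lra.
  have bound s t : 0 <= s -> s <= t ->
      t - s <= mdist (gamma s) (gamma t) <= t - s + 4 * `|C|.
    move=> s0 st; have [ds [Ns hs]] := hg s s0.
    have [dt [Nt ht]] := hg t (le_trans s0 st).
    have hs' := hs _ (leq_maxl Ns Nt); have ht' := ht _ (leq_maxr Ns Nt).
    have ht'' : s - C <= gromov_product p (x (maxn Ns Nt)) (gamma t).
      by rewrite gromov_productC; lra.
    have := four _ _ _ _ _ hs' ht''.
    rewrite /gromov_product (metric_sym _ p) (metric_sym (gamma t) p) ds dt.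
    have := metric_triangle p (gamma s) (gamma t); rewrite ds dt.
    by move=> h1 h2; apply/andP; split; lra.
  have {bound} bound s t : 0 <= s -> 0 <= t ->
      `|s - t| <= mdist (gamma s) (gamma t) <= `|s - t| + 4 * `|C|.
    move=> s0 t0; have [st|/ltW st] := leP s t.
      by rewrite distrC ger0_norm ?subr_ge0// bound.
    by rewrite metric_sym ger0_norm ?subr_ge0// bound.
  move=> s t s0 t0; have /andP[h1 h2] := bound s t s0 t0.
  have n0 := normr_ge0 (s - t); apply/andP; split.
    apply: le_trans h1; rewrite lerBlDr ler_wpDr ?addr_ge0 ?mulr_ge0//.
    by rewrite ler_piMl// invf_le1; lra.
  apply: le_trans h2 _; have : 0 <= `|C| * `|s - t| by rewrite mulr_ge0.
  by lra.
apply/(gromov_divergeP _ _ p) => r.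
have /(gromov_divergeP _ _ p)/(_ (r + C))[N hN] := divx.
have [N' hN'] : exists N' : nat, r + 2 * C <= N'%:R.
  by exists (Num.truncn (r + 2 * C)).+1; exact/ltW/truncnS_gt.
exists (maxn N N') => m n; rewrite !geq_max => /andP[m1 _] /andP[_ n2].
have [_ [N2 h2]] := hg n%:R (ler0n _ _).
rewrite -(addrK C r); apply: (four _ _ (x (maxn N N2))).
  by apply: hN => //; exact: leq_maxl.
rewrite gromov_productC; apply: le_trans (h2 _ (leq_maxr _ _)).
have : N'%:R <= n%:R :> R by rewrite ler_nat.
by lra.
Qed.

End quasigeodesic_representative.

(** * The horizontal boundary *)

Section horizontal.
Context {R : realType} {X : metricType R} {I : Type} {B : I -> set X}.
Variable B0 : forall i, B i !=set0.
Local Notation rho := (cone_rho B0).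

Lemma gprodE p x y : gprod rho p x y =
  gromov_product (cone_incl B0 p) (cone_incl B0 x) (cone_incl B0 y).
Proof. by []. Qed.

(** Every point is within 1 of [X]. Moving the base point and both arguments changes a product by at
    most 3, once before and once after using [four]. *)
Lemma cone_four_point C : four_point rho C ->
  four_point (@mdist R (coned_off B0)) (C + 6).
Proof.
move=> four p x y z r hxy hyz.
have [[p' hp] [x' hx] [y' hy] [z' hz]] :
  [/\ exists p', mdist p (cone_incl B0 p') <= 1,
      exists x', mdist x (cone_incl B0 x') <= 1,
      exists y', mdist y (cone_incl B0 y') <= 1 &
      exists z', mdist z (cone_incl B0 z') <= 1].
  by split; exact: cone_incl_dense.
have shift a b a' b' : mdist a (cone_incl B0 a') <= 1 ->
    mdist b (cone_incl B0 b') <= 1 -> r <= gromov_product p a b ->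
    r - 3 <= gprod rho p' a' b'.
  move=> ha hb; rewrite gprodE.
  have := gromov_product_shift (cone_incl B0 p') a b (cone_incl B0 a')
    (cone_incl B0 b').
  by have := gromov_product_base p (cone_incl B0 p') a b; lra.
have := four _ _ _ _ _ (shift _ _ _ _ hx hy hxy) (shift _ _ _ _ hy hz hyz).
rewrite gprodE -/(gromov_product p x z).
have := gromov_product_shift (cone_incl B0 p') (cone_incl B0 x') (cone_incl B0
  z') x z.
have := gromov_product_base (cone_incl B0 p') p x z.
rewrite (metric_sym _ x) (metric_sym _ z) (metric_sym _ p).
by change (gprod mdist p x z) with (gromov_product p x z); lra.
Qed.

Variables (delta c : R).
Hypotheses (d0 : 0 <= delta) (c0 : 0 <= c).
Hypothesis geoX : geodesic_space X.
Hypothesis slimX : slim_space delta X.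
Hypothesis mrho : coarsely_monotone rho c.

Let prho : dominated_pseudometric rho := cone_rho_dominated B0.

(** Uniformity in the point [w] is what gives continuity of the boundary map, besides the
    convergence of sequences equivalent to [x]. *)
Definition horizontal (x : nat -> X) := forall p L, exists r N, forall m w,
  (N <= m)%N -> r <= gromov_product p w (x m) -> L <= gprod rho p w (x m).

Lemma horizontal_base (x : nat -> X) p :
  (forall L, exists r N, forall m w, (N <= m)%N ->
    r <= gromov_product p w (x m) -> L <= gprod rho p w (x m)) -> horizontal x.
Proof.
have [rho0 rhoC rhoT rhod] := prho.
move=> h q L; have [r [N hN]] := h (L + rho p q).
exists (r + mdist q p), N => m w Nm hr.
have := gromov_product_base q p w (x m).
have := gromov_product_base (cone_incl B0 p) (cone_incl B0 q) (cone_incl B0 w)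
  (cone_incl B0 (x m)).
have := hN m w Nm; rewrite !gprodE -/(rho p q); lra.
Qed.

(** If the product of [w] and [x m] exceeds [D + delta], then [w, x m] passes too far from [p] to be
    near [u], so [u] is near [p, w]. Both geodesics from [p] thus pass near the [rho]-far point [u],
    which makes the [rho]-product large. *)
Lemma horizontalP (x : nat -> X) p :
  (forall L, exists D N, forall m, (N <= m)%N -> exists u,
    [/\ between p u (x m), mdist p u <= D & L <= rho p u]) -> horizontal x.
Proof.
have [rho0 rhoC rhoT rhod] := prho; have [hd hc] := (d0, c0).
move=> h; apply: (@horizontal_base x p) => L.
have [D [N hN]] := h (L + c + delta); exists (D + delta + 1), N => m w Nm hr.
have [u [hu pu Lu]] := hN m Nm; have [v [hv|hv] uv] := slimX w hu; last first.
  have := gprod_le_dist (@mdist_dominated _ X) (@mdist_monotone _ X) p hv.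
  have := metric_triangle p u v; rewrite mul0r addr0.
  by change (gprod mdist p w (x m)) with (gromov_product p w (x m)); lra.
have := mrho hv; have := mrho hu; rewrite /gprod (rhoC w p) (rhoC (x m) p).
have := rhoT v w (x m); have := rhoT u v (x m); have := rhoT v p u.
have := rhod u v; rewrite (rhoC w v) (rhoC v u); lra.
Qed.

Lemma horizontal_diverge (x w : nat -> X) : horizontal x ->
  gromov_diverge w x ->
  gromov_diverge (cone_incl B0 \o w) (cone_incl B0 \o x).
Proof.
move=> hx hw; pose p := x 0%N.
apply/(gromov_divergeP _ _ (cone_incl B0 p)) => L.
have [r [N hN]] := hx p L; have /(gromov_divergeP _ _ p)/(_ r)[N' hN'] := hw.
exists (maxn N N') => m n; rewrite !geq_max => /andP[_ m2] /andP[n1 n2].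
by have := hN n (w m) n1 (hN' m n m2 n2).
Qed.

Lemma cone_diverge_diverge (x y : nat -> X) :
  gromov_diverge (cone_incl B0 \o x) (cone_incl B0 \o y) -> gromov_diverge x y.
Proof.
move=> h; pose p := x 0%N; apply/(gromov_divergeP _ _ p) => r.
have /(gromov_divergeP _ _ (cone_incl B0 p))/(_ (r + (2 * delta + 1 + c /
  2)))[N hN] := h.
exists N => m n Nm Nn; have := hN m n Nm Nn; rewrite /= -gprodE.
by have := gprod_le_gromov_product p (x m) (y n) geoX slimX prho mrho; lra.
Qed.

(* With y = x_n0 far along the sequence, the point of [p, x_m] at d-distance
   just above d(p, y) is d-close to [y, x_m], which is rho-far from p. *)
Lemma cone_diverge_horizontal (x : nat -> X) :
  gromov_diverge (cone_incl B0 \o x) (cone_incl B0 \o x) -> horizontal x.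
Proof.
have [rho0 rhoC rhoT rhod] := prho; have [hd hc] := (d0, c0).
move=> hx; pose p := x 0%N; apply: (@horizontalP x p) => L.
have /(gromov_divergeP _ _ (cone_incl B0 p))/(_ (L + c / 2 + delta))[n0 hn0] :=
  hx.
pose D := mdist p (x n0) + delta + 1.
have /(gromov_divergeP _ _ p)/(_ D)[N hN] := cone_diverge_diverge hx.
exists D, (maxn n0 N) => m; rewrite geq_max => /andP[m1 m2].
have D0 : 0 <= D by have := mdist_ge0 p (x n0); rewrite /D; lra.
have [|u hu pu] := between_exists geoX (x := p) (y := x m) (t := D).
  rewrite D0/=; apply: le_trans (gromov_product_le_dist _ _ _); exact: hN.
exists u; split=> //; first by rewrite pu.
have [v [hv|hv] uv] := slimX (x n0) hu.
  have := between_le hv; have := metric_triangle p v u;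
    rewrite (metric_sym v u) pu /D.
  by lra.
have := gprod_le_dist prho mrho p hv; have := hn0 n0 m (leqnn _) m1.
rewrite /= -gprodE; have := rhoT u p v; have := rhod u v; lra.
Qed.

Lemma quasigeodesic_chain (gamma : R -> X) : quasigeodesic_ray gamma ->
  exists2 A, 0 <= A &
    (forall i j, (i <= j)%N ->
      j%:R - i%:R <= A * mdist (gamma i%:R) (gamma j%:R) + A) /\
    (forall i j, (i <= j)%N ->
      mdist (gamma i%:R) (gamma j%:R) <= A * (j%:R - i%:R) + A).
Proof.
move=> [K [K1 hK]]; have K0 : 0 <= K by lra.
have KK : K <= K * K by rewrite ler_peMr.
exists (K * K); first by rewrite mulr_ge0.
split=> i j ij; have ijR : i%:R <= j%:R :> R by rewrite ler_nat.
  have /andP[h _] := hK i%:R j%:R (ler0n _ _) (ler0n _ _).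
  have {}h := ler_wpM2l K0 h; rewrite mulrBr mulrA divff in h; last by lra.
  rewrite mul1r distrC ger0_norm ?subr_ge0// in h.
  have : K * mdist (gamma i%:R) (gamma j%:R) <= K * K * mdist (gamma i%:R)
    (gamma j%:R).
    by rewrite ler_wpM2r// mdist_ge0.
  by lra.
have /andP[_ h] := hK i%:R j%:R (ler0n _ _) (ler0n _ _).
rewrite distrC ger0_norm ?subr_ge0// in h.
have : K * (j%:R - i%:R) <= K * K * (j%:R - i%:R).
  by rewrite ler_wpM2r// subr_ge0.
by lra.
Qed.

Lemma quasigeodesic_near (gamma : R -> X) : quasigeodesic_ray gamma ->
  exists2 H, 0 <= H & forall j m, (j <= m)%N ->
    exists2 p, between (gamma 0) p (gamma m%:R) & mdist (gamma j%:R) p <= H.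
Proof.
move=> /quasigeodesic_chain[A A0 [hl hu]].
have [H H0 hH] := chain_near_geodesic d0 A0; exists H => // j m jm.
exact: (hH _ geoX slimX (fun n => gamma n%:R)).
Qed.

Lemma unbounded_quasigeodesic_horizontal (gamma : R -> X) :
  quasigeodesic_ray gamma ->
  ~ bounded_subset (cone_incl B0 @` ray_image gamma) ->
  horizontal (fun n => gamma n%:R).
Proof.
have [rho0 rhoC rhoT rhod] := prho.
move=> qg unb; have [H H0 hH] := quasigeodesic_near qg; have [K [K1 hK]] := qg.
apply: (@horizontalP _ (gamma 0)) => L.
(* [2 * K] pays for rounding [t] down to the integer [j], and [H] for moving [gamma j%:R] onto the
   geodesic. *)
have [t t0 ht] := unbounded_ray (gamma 0) unb (L + H + 2 * K).
pose j := Num.truncn t; have /andP[jt tj] := truncn_itv t0;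
  rewrite -/j in jt tj.
have hj : L + H <= rho (gamma 0) (gamma j%:R).
  have := rhoT (gamma j%:R) (gamma 0) (gamma t).
  have := rhod (gamma j%:R) (gamma t).
  have /andP[_] := hK j%:R t (ler0n _ _) t0;
    rewrite distrC ger0_norm ?subr_ge0//.
  have : K * (t - j%:R) <= K * 1.
    by rewrite ler_wpM2l//; [lra|rewrite lerBlDl natr1 ltW].
  by lra.
exists (mdist (gamma 0) (gamma j%:R) + H), j => m /hH[u hu ju]; exists u;
  split=> //.
  by have := metric_triangle (gamma 0) (gamma j%:R) u; lra.
have := rhoT u (gamma 0) (gamma j%:R); have := rhod (gamma j%:R) u.
by rewrite (rhoC (gamma j%:R) u); lra.
Qed.

Lemma horizontal_boundaryP (xi : gromov_boundary X) :
  horizontal_boundary B0 xi -> exists2 x, bdry_class xi x & horizontal x.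
Proof.
move=> [gamma [qg unb end_g]]; exists (fun n => gamma n%:R) => //.
exact: unbounded_quasigeodesic_horizontal.
Qed.

Lemma four_pointX : four_point (@mdist R X) (3 * delta + 1).
Proof.
have h := coarsely_monotone_four_point geoX slimX
  (@mdist_dominated _ X) (@mdist_monotone _ X).
by move=> p x y z r h1 h2; have := h p x y z r h1 h2; lra.
Qed.

(** A quasigeodesic ray to [xi] is [rho]-unbounded: its [rho]-products with [x] diverge and are at
    most its [rho]-distance to the start. *)
Lemma horizontal_in_boundary (xi : gromov_boundary X) x :
  bdry_class xi x -> horizontal x -> horizontal_boundary B0 xi.
Proof.
move=> xix hx; have divx := bdry_diverge four_pointX xix xix.
have [gamma qg dg] := quasigeodesic_ray_exists geoX four_pointX divx.
exists gamma; split=> //; last exact: (diverge_bdry four_pointX xix dg).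
have := horizontal_diverge hx (gromov_divergeC dg).
move=> /(gromov_divergeP _ _ (cone_incl B0 (gamma 0))) div [r hr].
have [N hN] := div (r + 1); have := hN N N (leqnn _) (leqnn _).
have := hr _ _ (cone_incl_ray B0 gamma (lexx 0)) (cone_incl_ray B0 gamma (ler0n
  _ N)).
have := gromov_product_le_dist (cone_incl B0 (gamma 0)) (cone_incl B0 (gamma
  N%:R)) (cone_incl B0 (x N)).
by rewrite /=; lra.
Qed.

End horizontal.

(** * The homeomorphism onto the boundary of the coned-off space *)

Section boundary_map.
Context {R : realType} {X : metricType R} {I : Type} {B : I -> set X}.
Variable B0 : forall i, B i !=set0.
Variables (delta c : R).
Hypotheses (d0 : 0 <= delta) (c0 : 0 <= c).
Hypothesis geoX : geodesic_space X.
Hypothesis slimX : slim_space delta X.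
Local Notation rho := (cone_rho B0).
Hypothesis mrho : coarsely_monotone rho c.

Local Notation hX := (set_type (horizontal_boundary B0)).

Let fourX := four_pointX geoX slimX.
Let fourC : exists C, four_point (@mdist R (coned_off B0)) C.
Proof.
by eexists; apply/cone_four_point/coarsely_monotone_four_point;
  first exact: geoX; [exact: slimX|exact: cone_rho_dominated|exact: mrho].
Qed.

Lemma cone_bdry_ex (eta : gromov_boundary (coned_off B0)) :
  exists x, bdry_class eta (cone_incl B0 \o x).
Proof.
have [C hC] := fourC; have [u eu] := bdry_ex eta.
have /choice[x hx] := fun n => cone_incl_dense (u n); exists x.
apply: (diverge_bdry hC eu); apply/(gromov_divergeP _ _ (u 0%N)) => r.
have /(gromov_divergeP _ _ (u 0%N))/(_ (r + 1))[N hN] := bdry_diverge hC eu eu.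
exists N => m n Nm Nn; have := hN m n Nm Nn; have := hx n.
have := gromov_product_shift (u 0%N) (u m) (u n) (u m) (cone_incl B0 (x n)).
by rewrite mdistxx /=; lra.
Qed.

Lemma horizontal_boundary_image (xi : hX) : exists eta :
  gromov_boundary (coned_off B0),
  forall w, bdry_class (set_val xi) w -> bdry_class eta (cone_incl B0 \o w).
Proof.
have [C hC] := fourC.
have [x xix hx] := horizontal_boundaryP d0 c0 geoX slimX mrho (set_valP xi).
have div w : bdry_class (set_val xi) w ->
    gromov_diverge (cone_incl B0 \o w) (cone_incl B0 \o x).
  by move=> xiw; apply: horizontal_diverge hx _;
    exact: (bdry_diverge fourX xiw xix).
exists (bdry_of (div x xix)) => w xiw.
apply: (diverge_bdry hC (bdry_ofP (div x xix))).
exact/gromov_divergeC/div.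
Qed.

Lemma horizontal_boundary_preimage (eta : gromov_boundary (coned_off B0)) :
  exists xi : hX, exists2 x, bdry_class (set_val xi) x &
    bdry_class eta (cone_incl B0 \o x).
Proof.
have [C hC] := fourC; have [x ex] := cone_bdry_ex eta.
have divx := bdry_diverge hC ex ex.
have divX := cone_diverge_diverge geoX slimX mrho divx.
have hor := cone_diverge_horizontal d0 c0 geoX slimX mrho divx.
have hb : horizontal_boundary B0 (bdry_of divX).
  exact: (horizontal_in_boundary geoX slimX (bdry_ofP divX) hor).
by exists (SigSub (mem_set hb)), x.
Qed.

(** Fixing representatives costs [2 * C], the four-point condition another [C], and the change of
    base point the last term. *)
Lemma bdry_product_four (M : metricType R) C p p' (a b e :
  gromov_boundary M) r :
  four_point (@mdist R M) C -> (r%:E < bdry_product p' a b)%E ->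
  (r%:E < bdry_product p' b e)%E ->
  ((r - 3 * C - mdist p' p)%:E <= bdry_product p a e)%E.
Proof.
move=> hC hab hbe; have [[u au] [[v bv] [w ew]]] :=
  (bdry_ex a, (bdry_ex b, bdry_ex e)).
have [N1 h1] := lt_bdry_product hC hab au bv.
have [N2 h2] := lt_bdry_product hC hbe bv ew.
apply: (le_bdry_product au ew); exists (maxn N1 N2) => m n.
rewrite !geq_max => /andP[m1 m2] /andP[n1 n2].
have := gromov_product_four hC (h1 m m m1 m1) (h2 m n m2 n2).
by have := gromov_product_base p' p (u m) (w n); lra.
Qed.

Lemma bdry_product_diag (M : metricType R) C p (a : gromov_boundary M) r :
  four_point (@mdist R M) C -> (r%:E < bdry_product p a a)%E.
Proof.
move=> hC; have [u au] := bdry_ex a.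
apply: lt_le_trans (_ : (r + 1)%:E <= _)%E; first by rewrite lte_fin ltrDl.
apply: (le_bdry_product au au).
exact: (gromov_divergeP _ _ p).1 (bdry_diverge hC au au) (r + 1).
Qed.

Lemma horizontal_boundary_homeo : exists f : hX ->
  gromov_boundary (coned_off B0),
  (forall (xi : hX) w, bdry_class (set_val xi) w ->
    bdry_class (f xi) (cone_incl B0 \o w)) /\ homeomorphism f.
Proof.
have [C hC] := fourC; have /choice[f hf] := horizontal_boundary_image.
have /choice[g hg] := horizontal_boundary_preimage.
exists f; split=> //; split.
  apply/continuousP => U oU; pose V := [set xi : gromov_boundary X |
    exists p r, forall zeta : hX,
      (r%:E < bdry_product p xi (set_val zeta))%E -> U (f zeta)].
  exists V.
    move=> xi [p [r hr]] p';
      exists (r + 3 * (3 * delta + 1) + mdist p' p + 1) => eta hx.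
    exists p', (r + 3 * (3 * delta + 1) + mdist p' p + 1) => zeta hz; apply: hr.
    apply: lt_le_trans (bdry_product_four p fourX hx hz).
    by rewrite lte_fin; lra.
  apply/seteqP; split=> xi /=.
    by move=> [p [r]]; apply; exact: bdry_product_diag fourX.
  move=> Ufxi.
  have [x xix hx] := horizontal_boundaryP d0 c0 geoX slimX mrho (set_valP xi).
  pose p := x 0%N; have [L hL] := oU _ Ufxi (cone_incl B0 p).
  have [r [N hN]] := hx p (L + 1).
  exists p, (r + 2 * (3 * delta + 1)) => zeta hz; apply: hL.
  have [z zz] := bdry_ex (set_val zeta).
  have [N' hN'] := lt_bdry_product fourX hz xix zz.
  apply: lt_le_trans (_ : (L + 1)%:E <= _)%E; first by rewrite lte_fin ltrDl.
  apply: (le_bdry_product (hf _ _ xix) (hf _ _ zz)); exists (maxn N N') => m n.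
  rewrite !geq_max => /andP[m1 m2] /andP[n1 n2] /=.
  rewrite gromov_productC -gprodE; apply: hN => //.
  by rewrite gromov_productC; have := hN' m n m2 n2; lra.
exists g; split.
- apply/continuousP => _ [V oV <-].
  suff: bdry_open (g @^-1` (set_val @^-1` V)) by [].
  move=> eta /= Vg q.
  have [x gx ex] := hg eta; pose p := x 0%N; have [r hr] := oV _ Vg p.
  pose D := 2 * delta + 1 + c / 2.
  (* Continuity of the inverse: large coned-off products force large products in [X], with [D] for
     the comparison, [2 * C] for the representatives, a change of base point, and 1 for
     strictness. *)
  exists (r + 1 + D + mdist q (cone_incl B0 p) + 2 * C) => eta' heta; apply: hr.
  have [x' gx' ex'] := hg eta'; have [N hN] := lt_bdry_product hC heta ex ex'.
  apply: lt_le_trans (_ : (r + 1)%:E <= _)%E; first by rewrite lte_fin ltrDl.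
  apply: (le_bdry_product gx gx'); exists N => m n Nm Nn.
  have := hN m n Nm Nn; rewrite /=.
  have := gromov_product_base q (cone_incl B0 p) (cone_incl B0 (x m))
    (cone_incl B0 (x' n)).
  rewrite -gprodE.
  have := gprod_le_gromov_product p (x m) (x' n) geoX slimX (cone_rho_dominated
    B0) mrho.
  by rewrite -/D; lra.
- move=> xi; have [x gx fx] := hg (f xi); apply: val_inj.
  have [w xiw] := bdry_ex (set_val xi).
  apply: (bdry_eq fourX gx xiw); apply/(cone_diverge_diverge geoX slimX mrho).
  exact: (bdry_diverge hC fx (hf _ _ xiw)).
- move=> eta; have [x gx ex] := hg eta.
  by apply: (bdry_eq hC (hf _ _ gx) ex); exact: (bdry_diverge hC ex ex).
Qed.

End boundary_map.

(** * Locally finite families *)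

Section locally_finite.
Context {R : realType} {X : metricType R} {I : Type} {B : I -> set X}.
Variable B0 : forall i, B i !=set0.
Variables (delta k : R).
Hypotheses (k0 : 0 <= k) (d0 : 0 <= delta).
Hypothesis geoX : geodesic_space X.
Hypothesis slimX : slim_space delta X.
Hypothesis qcB : forall i, quasiconvex k (B i).

(** Each hop splits off two pieces of the geodesic, one near [x, a] of bounded diameter and one near
    [a, b], hence near [B i] by quasiconvexity. The pieces of the remaining path are thickened by
    [2 * delta]. *)
Lemma hops_cover n x y l : hops B n x y l -> exists S : nat -> set X,
  (forall p, between x p y -> exists2 i, (i < n.*2.+1)%N & S i p) /\
  forall i, (forall a b, S i a -> S i b ->
    mdist a b <= 2 * l + 4 * delta * n.+1%:R) \/
    exists j, forall a, S i a ->
      exists2 b, B j b & mdist a b <= k + 2 * delta * n%:R.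
Proof.
have [hd hk] := (d0, k0).
have diam (x' y' u v : X) : between x' u y' -> between x' v y' ->
  mdist u v <= 2 * mdist x' y'.
  move=> /between_le hu /between_le hv; have := metric_triangle u x' v.
  by rewrite (metric_sym u x'); lra.
elim=> {n x y l} [x y|i x a b y n l Ba Bb h [S [coverS typeS]]].
  exists (fun=> [set p | between x p y]); split=> [p hp|_]; first by exists 0%N.
  by left=> u v hu hv; have := diam _ _ _ _ hu hv; rewrite mulr1; lra.
have l0 := hops_ge0 h; have dxa := mdist_ge0 x a;
  have n0 : 0 <= n%:R :> R by [].
have dn0 : 0 <= delta * n%:R by rewrite mulr_ge0.
have e1 : n.+1%:R = n%:R + 1 :> R by rewrite natr1.
have e2 : n.+2%:R = n%:R + 1 + 1 :> R by rewrite !natr1.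
pose S' m : set X := match m with
  | 0 => [set p | exists2 q, between x q a & mdist p q <= delta]
  | 1 => [set p | exists2 q, between a q b & mdist p q <= 2 * delta]
  | m.+2 => [set p | exists2 q, S m q & mdist p q <= 2 * delta] end.
exists S'; split=> [p hp|[|[|m]]].
- have [q [hq|hq] pq] := slimX a hp; first by exists 0%N => //; exists q.
  have [q' hq' qq'] := slimX b hq.
  have pq' : mdist p q' <= 2 * delta by have := metric_triangle p q q'; lra.
  case: hq' => hq'; first by exists 1%N; [rewrite doubleS|exists q'].
  by have [m hm Sm] := coverS _ hq'; exists m.+2; [rewrite doubleS|exists q'].
- left=> u v [u' hu uu'] [v' hv vv']; have := diam _ _ _ _ hu hv.
  have := metric_triangle u u' v; have := metric_triangle u' v' v.
  by rewrite (metric_sym v' v) e2; lra.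
- right; exists i => u [u' hu uu'].
  have [b' Bb' hb'] := quasiconvex_between geoX qcB Ba Bb hu; exists b' => //.
  by have := metric_triangle u u' b'; rewrite e1; lra.
- have [hS|[j hS]] := typeS m; [left|right].
    move=> u v [u' hu uu'] [v' hv vv']; have := hS _ _ hu hv.
    have := metric_triangle u u' v; have := metric_triangle u' v' v.
    by rewrite (metric_sym v' v) e1 e2; lra.
  exists j => u [u' hu uu']; have [b' Bb' hb'] := hS _ hu; exists b' => //.
  by have := metric_triangle u u' b'; rewrite e1; lra.
Qed.

Lemma pigeonhole N (f : nat -> nat) : (forall l, (l <= N)%N -> (f l < N)%N) ->
  exists l l', [/\ (l < l')%N, (l' <= N)%N & f l = f l'].
Proof.
move=> hf; pose g (l : 'I_N.+1) : 'I_N := Ordinal (hf l (ltn_ord l)).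
have /injectivePn[l [l' ne eq]] : ~~ injectiveb g.
  by apply/negP => /injectiveP/leq_card; rewrite !card_ord ltnn.
have {}eq : f l = f l' by case: eq.
have [lt|lt|e] := ltngtP l l'.
- by exists l, l'; split; rewrite // -ltnS ltn_ord.
- by exists l', l; split; rewrite // -ltnS ltn_ord.
- by move: ne; rewrite (val_inj e) eqxx.
Qed.

Hypothesis lfB : locally_finite_family B.

(* Otherwise there are indices T_0 < T_1 < ... such that the z (T_l) are far
   apart and no member of B is near two of them; too many of them lie near a
   single [z 0, z m]. *)
Lemma bounded_chain_recurrent (z : nat -> X) A H L :
  0 <= A -> 0 <= H ->
  (forall i j, (i <= j)%N -> j%:R - i%:R <= A * mdist (z i) (z j) + A) ->
  (forall j m, (j <= m)%N ->
    exists2 p, between (z 0) p (z m) & mdist (z j) p <= H) ->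
  (forall m, cone_rho B0 (z 0) (z m) <= L) ->
  exists j r, forall T0, exists2 T, (T0 <= T)%N & exists2 b, B j b &
    mdist (z T) b <= r.
Proof.
move=> A0 H0 zl near zL; have [hd hk] := (d0, k0).
have [Nb hNb] : exists N : nat, L + 1 <= N%:R.
  by exists (Num.truncn (L + 1)).+1; exact/ltW/truncnS_gt.
(* Paths from [z 0] to any [z m] can be taken with [l <= L + 1] and at most [Nb] hops. [r] and [Lam]
   are then the bounds of [hops_cover] for the two kinds of pieces, enlarged by [H] because [z] is
   only [H]-near the geodesic. *)
pose r := H + k + 2 * delta * Nb%:R.
pose Lam := 2 * (L + 1) + 4 * delta * Nb.+1%:R + 2 * H.
pose nearB T j := exists2 b, B j b & mdist (z T) b <= r.
apply: contrapT => nrec.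
have escape j : exists T0, forall T, (T0 <= T)%N -> ~ nearB T j.
  apply: contrapT => h; apply: nrec; exists j, r => T0.
  apply: contrapT => h'; apply: h; exists T0 => T hT hn; apply: h'.
  by exists T.
(* By local finiteness only finitely many members are near [z T], so a single index passes all their
   escape times. *)
have /choice[next hnext] : forall T, exists T', [/\ (T < T')%N,
    forall j, nearB T j -> forall T'', (T' <= T'')%N -> ~ nearB T'' j
    & forall T'', (T' <= T'')%N -> Lam < mdist (z T) (z T'')].
  move=> T; have [esc hesc] := choice escape.
  have finF : finite_set [set j | nearB T j].
    have r1 : 0 < `|r| + 1 by rewrite ltr_pwDr.
    apply: sub_finite_set (lfB (z T) r1) => j [b Bb hb]; exists b; split=> //.
    by rewrite ballEmdist /=; have := ler_norm r; lra.
  have [M hM] : exists M, forall j, nearB T j -> (esc j <= M)%N.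
    have /finite_seqP[s hs] : finite_set (esc @` [set j | nearB T j]).
      exact: finite_image.
    exists (\max_(i <- s) i) => j hj;
      apply: (@leq_bigmax_seq _ s xpredT id) => //.
    have : (esc @` [set j | nearB T j]) (esc j) by exists j.
    by rewrite hs.
  have [M' hM'] : exists M' : nat, A * Lam + A + T%:R < M'%:R.
    by exists (Num.truncn (A * Lam + A + T%:R)).+1; exact: truncnS_gt.
  exists (maxn T.+1 (maxn M M')); split.
  - by rewrite leq_max leqnn.
  - move=> j hj T''; rewrite !geq_max => /and3P[_ hT _]; apply: hesc.
    exact: leq_trans (hM _ hj) hT.
  - move=> T''; rewrite !geq_max => /and3P[hT _ hT']; rewrite ltNge;
      apply/negP => h.
    have := zl T T'' (ltnW hT); have := ler_wpM2l A0 h.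
    have : M'%:R <= T''%:R :> R by rewrite ler_nat.
    by lra.
pose T l := iter l next 0%N.
have T_mono l l' : (l <= l')%N -> (T l <= T l')%N.
  move=> /subnK <-; elim: (l' - l)%N => // m IH; rewrite addSn /=.
  by apply: leq_trans IH _; apply: ltnW; have [] := hnext (T (m + l)%N).
(* At most [N] pieces cover the geodesic, while the indices [T 0], ..., [T N] are [N + 1] in number:
   two of them share a piece. *)
pose N := Nb.*2.+1.
have [n [l [hn hl]]] := cone_dist_hops B0 (z 0%N) (z (T N)).
have l0 := hops_ge0 hn; have := zL (T N); rewrite /cone_rho /mdist/= => zLN.
have n0 : 0 <= n%:R :> R by [].
have lL : l <= L + 1 by lra.
have nR : n%:R <= Nb%:R :> R by lra.
have nNb : (n <= Nb)%N by rewrite -(ler_nat R).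
have [S [coverS typeS]] := hops_cover hn.
have /choice[p hp] : forall l, exists p, (l <= N)%N ->
    between (z 0) p (z (T N)) /\ mdist (z (T l)) p <= H.
  move=> l'; have [lN|_] := leqP l' N; last by exists (z 0%N).
  by have [p ? ?] := near _ _ (T_mono _ _ lN); exists p.
have /choice[idx hidx] : forall l, exists i, (l <= N)%N ->
  (i < N)%N /\ S i (p l).
  move=> l'; have [lN|_] := leqP l' N; last by exists 0%N.
  have [i hi Si] := coverS _ (hp _ lN).1; exists i => _; split=> //.
  by apply: leq_trans hi _; rewrite ltnS leq_double.
have [|a [b [ab bN eab]]] := @pigeonhole N idx; first by move=> l' /hidx[].
have aN := leq_trans (ltnW ab) bN.
have [[_ Sa] [_ Sb]] := (hidx _ aN, hidx _ bN).
have [[_ za] [_ zb]] := (hp _ aN, hp _ bN); rewrite -eab in Sb.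
have [_ sep far] := hnext (T a).
have Tab : (next (T a) <= T b)%N by exact: (T_mono a.+1 b).
have dn : delta * n.+1%:R <= delta * Nb.+1%:R by rewrite ler_wpM2l// ler_nat
  ltnS.
have dn' : delta * n%:R <= delta * Nb%:R by rewrite ler_wpM2l.
have [hS|[j hS]] := typeS (idx a).
  have := hS _ _ Sa Sb; have := far _ Tab.
  have := metric_triangle (z (T a)) (p a) (z (T b)).
  have := metric_triangle (p a) (p b) (z (T b)).
  by rewrite (metric_sym (p b) (z (T b))) /Lam; lra.
have [[a' Ba ha] [b' Bb hb]] := (hS _ Sa, hS _ Sb).
apply: (sep j _ _ Tab).
  by exists a' => //; have := metric_triangle (z (T a)) (p a) a'; rewrite /r;
    lra.
by exists b' => //; have := metric_triangle (z (T b)) (p b) b'; rewrite /r; lra.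
Qed.

Lemma bounded_quasigeodesic_limit (gamma : R -> X) (xi : gromov_boundary X) :
  quasigeodesic_ray gamma -> bounded_subset (cone_incl B0 @` ray_image gamma) ->
  ray_endpoint gamma xi -> exists j, limit_set (B j) xi.
Proof.
move=> qg [L hL] xi_g; have [A A0 [zl _]] := quasigeodesic_chain qg.
have [H H0 near] := quasigeodesic_near d0 geoX slimX qg.
have zL m : cone_rho B0 (gamma 0%:R) (gamma m%:R) <= L by apply: hL;
  exact: cone_incl_ray.
have [j [r hj]] := @bounded_chain_recurrent (fun n =>
  gamma n%:R) _ _ _ A0 H0 zl near zL.
have /choice[T hT] : forall n, exists T, (n <= T)%N /\
    exists2 b, B j b & mdist (gamma T%:R) b <= r.
  by move=> n; have [T nT hb] := hj n; exists T.
have /choice[u hu] : forall n, exists b, B j b /\ mdist (gamma (T n)%:R) b <= r.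
  by move=> n; have [_ [b Bb hb]] := hT n; exists b.
exists j, u; first by move=> n; exact: (hu n).1.
have four := four_pointX geoX slimX.
apply: (diverge_bdry four xi_g); apply/(gromov_divergeP _ _ (gamma 0)) => s.
have /(gromov_divergeP _ _ (gamma 0))/(_ (s + r))[N hN] :=
  bdry_diverge four xi_g xi_g.
exists N => m n Nm Nn; have := hN m (T n) Nm (leq_trans Nn (hT n).1).
have := gromov_product_shift (gamma 0) (gamma m%:R) (gamma (T n)%:R) (gamma
  m%:R) (u n).
by have := (hu n).2; rewrite mdistxx; lra.
Qed.

End locally_finite.

(** * Conclusion: uniform constants and the three statements *)

Lemma geodesic_ray_quasigeodesic (R : realType) (M : metricType R) (gamma :
  R -> M) :
  geodesic_ray gamma -> quasigeodesic_ray gamma.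
Proof.
move=> hg; exists 1; split=> // s t s0 t0.
by rewrite hg /= ?in_itv/= ?andbT// invr1 !mul1r; apply/andP; split; lra.
Qed.

Theorem theorem2 (R : realType) (k delta : R) (hk : 0 <= k) (hdelta : 0 <= delta) :
  exists K Rad : R, [/\ 0 <= K, 0 <= Rad &
  forall (X : metricType R) (I : Type) (B : I -> set X)
    (B0 : forall i, B i !=set0),
  geodesic_space X -> hyperbolic delta X ->
  (forall i, quasiconvex k (B i)) ->
  geodesic_space (coned_off B0) ->
  [/\ (* (1) *)
      forall gamma : R -> X, geodesic_ray gamma ->
        ~ bounded_subset (cone_incl B0 @` ray_image gamma) ->
        (exists beta : R -> coned_off B0,
          [/\ quasigeodesic_ray_with K beta, beta 0 = cone_incl B0 (gamma 0)
            & (hausdorff_dist (cone_incl B0 @` ray_image gamma)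
                 (ray_image beta) <= Rad%:E)%E]) /\
        (exists xi : gromov_boundary (coned_off B0),
          converges_to (fun n => cone_incl B0 (gamma n%:R)) xi),
      (* (2) *)
      exists f : set_type (horizontal_boundary B0) ->
                 gromov_boundary (coned_off B0),
        (forall (xi : set_type (horizontal_boundary B0)) (gamma : R -> X),
           quasigeodesic_ray gamma ->
           ~ bounded_subset (cone_incl B0 @` ray_image gamma) ->
           ray_endpoint gamma (set_val xi) ->
           converges_to (fun n => cone_incl B0 (gamma n%:R)) (f xi)) /\
        homeomorphism f
    & (* (3) *)
      locally_finite_family B ->
        (forall gamma : R -> X, geodesic_ray gamma ->
          bounded_subset (cone_incl B0 @` ray_image gamma) ->
          exists xi, ray_endpoint gamma xi /\
            exists j, limit_set (B j) xi) /\
        [set: gromov_boundary X] =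
          horizontal_boundary B0 `|` \bigcup_i limit_set (B i)]].
Proof.
have C0 : 0 <= 5 + k + 4 * delta by lra.
(* [c] is obtained before [X] and [B] are introduced, so [K] and [Rad] depend only on [k] and
   [delta]. *)
have [c c0 hc] := coarsely_geodesic_monotone hdelta C0.
exists (`|c| + 1), `|c|; split; rewrite ?addr_ge0//.
move=> X I B B0 geoX hypX qcB geoC.
have slimX := hyperbolic_slim geoX hypX.
have mrho : coarsely_monotone (cone_rho B0) c.
  apply: hc => //; first exact: cone_rho_dominated.
  exact: cone_rho_coarsely_geodesic.
split.
- move=> gamma ray_g unb; split; first exact: geodesic_ray_shadow.
  have div := geodesic_ray_cone_diverge mrho ray_g unb.
  by exists (bdry_of div).
- have [f [hf homeo_f]] := horizontal_boundary_homeo hdelta c0 geoX slimX mrho.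
  by exists f; split=> // xi gamma _ _; exact: hf.
move=> lfB; split=> [gamma ray_g bd|].
  have div := geodesic_ray_diverge ray_g; exists (bdry_of div); split=> //.
  by apply: (bounded_quasigeodesic_limit hk hdelta geoX slimX qcB lfB _ bd);
    first exact: geodesic_ray_quasigeodesic.
(* Each boundary point is represented by a quasigeodesic ray, and the dichotomy is whether that ray
   is bounded in the coned-off space. *)
apply/seteqP; split=> // xi _; have four := four_pointX geoX slimX.
have [x xix] := bdry_ex xi.
have [gamma qg dg] :=
  quasigeodesic_ray_exists geoX four (bdry_diverge four xix xix).
have xig : ray_endpoint gamma xi := diverge_bdry four xix dg.
have [bd|unb] := pselect (bounded_subset (cone_incl B0 @` ray_image gamma)).
  have [j hj] :=
    bounded_quasigeodesic_limit hk hdelta geoX slimX qcB lfB qg bd xig.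
  by right; exists j.
by left; exists gamma.
Qed.
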